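(* Let $(E_i)_{i\in V}$ be the non-singleton (nonempty) compact components in $\mathbb R^d$ of a finite strongly connected graph-directed system of contracting similarities, $$E_i=\bigcup_{j\in V}\ \bigcup_{e\in\mathscr E_{ij}}S_e(E_j)\qquad(i\in V)$$ (no separation condition is assumed). Then all the $E_i$ have a common Hausdorff and packing dimension $s$, and $s>0$; that is, there is $s>0$ with $\dim_{\mathrm H}E_i=\dim_{\mathrm P}E_i=s$ for every $i\in V$. For every $i\in V$ and every finite $\delta>0$, $$\mathcal M^s_\infty(E_i)=\mathcal M^s_\delta(E_i)=\mathcal M^s(E_i)<\infty.$$
   Context: Graph-directed system: a finite directed (multi)graph with vertex set $V$ and finite sets $\mathscr E_{ij}$ of edges from $i$ to $j$, such that every vertex can be reached from every vertex by a directed path (strong connectivity); to each edge $e$ is attached a similarity $S_e$ of $\mathbb R^d$ with ratio in $(0,1)$. $\dim_{\mathrm H}$, $\dim_{\mathrm P}$ are Hausdorff and packing dimension. Labelled packing quantities on $\mathbb R^d$ (Euclidean metric). $|E|$ is the diameter, $|\varnothing|=0$. For $s>0$, nonempty $E\subset\mathbb R^d$ and $0<R<\infty$ with $|E|\le R$, $$\Phi^s(E,R):=\sup\Big\{\sum_{i=1}^N(2r_i)^s: N\ge1,\ x_i\in\overline E,\ 0<r_i\le R,\ |x_i-x_j|\ge r_i+r_j\ (i\ne j)\Big\},$$ and $\Phi^s(\varnothing,R):=0$. For $0<\delta<\infty$, $$\mathcal M^s_\delta(F):=\inf\Big\{\sum_{j=1}^\infty\Phi^s(E_j,R_j):F\subseteq\bigcup_{j}E_j,\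 |E_j|\le R_j\le\delta,\ R_j>0\Big\},$$ $\mathcal M^s(F):=\lim_{\delta\downarrow0}\mathcal M^s_\delta(F)=\sup_{0<\delta<1}\mathcal M^s_\delta(F)$, and $$\mathcal M^s_\infty(F):=\inf\Big\{\sum_j\Phi^s(E_j,R_j):F\subseteq\bigcup_jE_j,\ |E_j|\le R_j,\ 0<R_j<\infty\Big\}$$ (countable covers). *)

(* Defs.v *)
From HB Require Import structures.
From mathcomp Require Import all_boot all_order all_algebra.
From mathcomp Require Import all_classical all_reals all_analysis.

Set Implicit Arguments.
Unset Strict Implicit.
Unset Printing Implicit Defensive.

Import Order.TTheory GRing.Theory Num.Theory.
Import numFieldNormedType.Exports.

Local Open Scope classical_set_scope.
Local Open Scope ring_scope.

(* R^d is 'rV[R]_d. Its library norm is the sup norm, so every metric notion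
   below goes through the Euclidean distance edist; only topological notions
   (compact, closure) use the library structure, the two topologies being the
   same. *)
Definition edist (R : realType) (d : nat) (x y : 'rV[R]_d) : R :=
  Num.sqrt (\sum_(k < d) (x 0 k - y 0 k) ^+ 2).

Definition ecball (R : realType) (d : nat) (x : 'rV[R]_d) (r : R) :
    set 'rV[R]_d :=
  [set y | edist x y <= r].

(* The element 0 is added only to give the empty set diameter 0. *)
Definition diam (R : realType) (d : nat) (A : set 'rV[R]_d) : \bar R :=
  ereal_sup ([set 0%E] `|` [set (edist x y)%:E | x in A & y in A]).

Definition contracting_similarity (R : realType) (d : nat)
    (f : 'rV[R]_d -> 'rV[R]_d) : Prop :=
  exists2 c : R, 0 < c < 1 & forall x y, edist (f x) (f y) = c * edist x y.

(* edge i j is the set of edges from i to j of a directed multigraph. *)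
Definition strongly_connected (V : finType) (edge : V -> V -> finType) : Prop :=
  forall i j : V, connect [rel k l | (0 < #|{: edge k l}|)%N] i j.

Section Dimensions.
Context (R : realType) (d : nat).
Implicit Types (s delta : R) (F : set 'rV[R]_d).

Definition hausdorff_content s delta F : \bar R :=
  ereal_inf [set (\sum_(j <oo) (diam (U j) `^ s))%E | U in
    [set U : nat -> set 'rV[R]_d |
      F `<=` \bigcup_j U j /\ forall j, (diam (U j) <= delta%:E)%E]].

Definition hausdorff_measure s F : \bar R :=
  ereal_sup [set hausdorff_content s delta F | delta in [set delta | 0 < delta]].

(* Restricting to s > 0 avoids the convention for 0 ^ 0 and does not change
   the infimum. *)
Definition hausdorff_dim F : \bar R :=
  ereal_inf [set s%:E | s in [set s | 0 < s /\ hausdorff_measure s F = 0%E]].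

Definition packing_premeasure_at s delta F : \bar R :=
  ereal_sup [set v | exists (N : nat) (x : 'I_N -> 'rV[R]_d) (r : 'I_N -> R),
    [/\ forall i, F (x i),
        forall i, 0 < r i <= delta,
        trivIset setT (fun i => ecball (x i) (r i))
      & v = (\sum_(i < N) (2 * r i) `^ s)%:E]].

Definition packing_premeasure s F : \bar R :=
  ereal_inf [set packing_premeasure_at s delta F
            | delta in [set delta | 0 < delta]].

Definition packing_measure s F : \bar R :=
  ereal_inf [set (\sum_(j <oo) packing_premeasure s (U j))%E | U in
    [set U : nat -> set 'rV[R]_d | F `<=` \bigcup_j U j]].

Definition packing_dim F : \bar R :=
  ereal_inf [set s%:E | s in [set s | 0 < s /\ packing_measure s F = 0%E]].

End Dimensions.

Section LabelledPacking.
Context (R : realType) (d : nat).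
Implicit Types (s rho delta : R) (E F : set 'rV[R]_d).

(* Phi^s(E, rho); only used when diam E <= rho. *)
Definition Phi s E rho : \bar R :=
  if E == set0 then 0%E else
  ereal_sup [set v | exists (N : nat) (x : 'I_N -> 'rV[R]_d) (r : 'I_N -> R),
    [/\ (1 <= N)%N,
        forall i, closure E (x i),
        forall i, 0 < r i <= rho,
        forall i j, i != j -> r i + r j <= edist (x i) (x j)
      & v = (\sum_(i < N) (2 * r i) `^ s)%:E]].

(* Countable covers are indexed by nat; the sets E_j may be empty. *)
Definition M_infty s F : \bar R :=
  ereal_inf [set v | exists (E : nat -> set 'rV[R]_d) (rho : nat -> R),
    [/\ F `<=` \bigcup_j E j,
        forall j, (diam (E j) <= (rho j)%:E)%E,
        forall j, 0 < rho j
      & v = (\sum_(j <oo) Phi s (E j) (rho j))%E]].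

Definition M_delta s delta F : \bar R :=
  ereal_inf [set v | exists (E : nat -> set 'rV[R]_d) (rho : nat -> R),
    [/\ F `<=` \bigcup_j E j,
        forall j, (diam (E j) <= (rho j)%:E)%E,
        forall j, 0 < rho j <= delta
      & v = (\sum_(j <oo) Phi s (E j) (rho j))%E]].

(* M_delta is nonincreasing in delta, so this is its limit as delta -> 0+. *)
Definition M_lim s F : \bar R :=
  ereal_sup [set M_delta s delta F | delta in [set delta | 0 < delta < 1]].

End LabelledPacking.

(* Main.v *)
(* Strong connectivity makes every component E quasi-self-similar: each ball
   B(x, r) centred in E contains a similar copy f(E) of E with ratio at least
   a * r. If finitely many disjoint copies of E in E, at least two, satisfy
   sum c_i^t >= 1, then E is not H^t-null. Hence, for s = dim_H E, disjoint
   copies satisfy sum c_i^s <= 1, which bounds sum r_i^s over all packings of E, and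
   dim_P E <= s. A cover of E by grid cubes, split into boundedly many classes
   of pairwise distant cubes, compares sums of Phi^s with one packing.

   For M^s_delta <= M^s_infty, choose a finite disjoint family of small copies
   of E with sum c_i^s almost maximal. Rescaling a cover of E covers these
   copies at total cost at most sum c_i^s <= 1 times the cost of that cover.
   The rest of E is covered by cubes shrinking towards the copies; by near
   maximality every packing of it that avoids the copies has small sum, so its
   cost is small. No measure-theoretic property of M^s is used, so the case
   H^s(E) = 0, possible without separation, needs no special treatment. *)
Require Import Defs.
From HB Require Import structures.
From mathcomp Require Import all_boot all_order all_algebra.
From mathcomp Require Import all_classical all_reals all_analysis.
From mathcomp Require Import ring lra.
(* Imported again because all_analysis has another [edist]. *)
Require Import Defs.

Set Implicit Arguments.
Unset Strict Implicit.
Unset Printing Implicit Defensive.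

Import Order.TTheory GRing.Theory Num.Theory.
Import numFieldNormedType.Exports.

Local Open Scope classical_set_scope.
Local Open Scope ring_scope.

(** * Euclidean distance and topology *)

(** The obstacle is overlap. The pieces given by the system cover [E], but without separation the
    s-th powers of their ratios may add up to more than 1, so transporting a cover to all pieces
    would lose a factor. Disjoint copies lose nothing, but they need not cover [E]; hence the two
    ingredients, a bound 1 for disjoint copies and an estimate of what they leave over. The bound 1
    holds even if [E] is null for the exponent s: a sum exceeding 1 would still be at least 1 for a
    slightly larger exponent, for which [E] is null by the definition of dimension. Near maximality
    controls the remainder because the balls of a packing that avoids the copies can be filled with
    further copies. Beyond quasi-self-similarity, the graph serves only to carry the dimension from
    one component to another; all other arguments concern a single compact set. *)

Section Euclidean.
Context {R : realType} {d : nat}.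
Implicit Types (x y z : 'rV[R]_d) (A B K : set 'rV[R]_d).

Lemma edist_ge0 x y : 0 <= edist x y.
Proof. exact: sqrtr_ge0. Qed.

Lemma edistxx x : edist x x = 0.
Proof.
by rewrite /edist big1 ?sqrtr0// => k _; rewrite subrr expr0n.
Qed.

Lemma edistC x y : edist x y = edist y x.
Proof.
by rewrite /edist; congr Num.sqrt; apply: eq_bigr => k _; rewrite -sqrrN opprB.
Qed.

Lemma sqr_sum_ge0 (a : 'I_d -> R) : 0 <= \sum_k a k ^+ 2.
Proof. by apply: sumr_ge0 => k _; exact: sqr_ge0. Qed.

Lemma cauchy_schwarz_sum (a b : 'I_d -> R) :
  \sum_k a k * b k <= Num.sqrt (\sum_k a k ^+ 2) * Num.sqrt (\sum_k b k ^+ 2).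
Proof.
set p := Num.sqrt (\sum_k a k ^+ 2); set q := Num.sqrt (\sum_k b k ^+ 2).
have p0 : 0 <= p by exact: sqrtr_ge0.
have q0 : 0 <= q by exact: sqrtr_ge0.
have p2 : p ^+ 2 = \sum_k a k ^+ 2 by rewrite sqr_sqrtr// sqr_sum_ge0.
have q2 : q ^+ 2 = \sum_k b k ^+ 2 by rewrite sqr_sqrtr// sqr_sum_ge0.
have zero (c e : 'I_d -> R) : \sum_k c k ^+ 2 = 0 -> \sum_k c k * e k = 0.
  move=> /eqP; rewrite psumr_eq0; last by move=> k _; exact: sqr_ge0.
  move=> /allP c0; rewrite big1// => k _.
  by have := c0 k (mem_index_enum k); rewrite sqrf_eq0 => /eqP ->; rewrite mul0r.
have [p_eq0|p_neq0] := eqVneq p 0.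
  by rewrite p_eq0 mul0r zero// -p2 p_eq0 expr0n.
have [q_eq0|q_neq0] := eqVneq q 0.
  rewrite q_eq0 mulr0; under eq_bigr do rewrite mulrC.
  by rewrite zero// -q2 q_eq0 expr0n.
have pq : 0 < 2 * (p * q) by rewrite !mulr_gt0// lt_def ?p_neq0 ?q_neq0 ?p0 ?q0.
have : 0 <= \sum_k (q * a k - p * b k) ^+ 2.
  by apply: sumr_ge0 => k _; exact: sqr_ge0.
have -> : \sum_k (q * a k - p * b k) ^+ 2 =
    q ^+ 2 * \sum_k a k ^+ 2 - 2 * (p * q) * \sum_k a k * b k
    + p ^+ 2 * \sum_k b k ^+ 2.
  by rewrite !mulr_sumr -sumrB -big_split; apply: eq_bigr => k _ /=; ring.
rewrite -p2 -q2 => h; rewrite -(ler_pM2l pq); lra.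
Qed.

Lemma edist_triangle y x z : edist x z <= edist x y + edist y z.
Proof.
rewrite -[leLHS]ger0_norm ?edist_ge0// -sqrtr_sqr -[leRHS]ger0_norm; last first.
  by rewrite addr_ge0// edist_ge0.
rewrite -sqrtr_sqr ler_sqrt ?sqr_ge0//.
rewrite sqrrD /edist !sqr_sqrtr ?sqr_sum_ge0//.
set a := fun k => x 0 k - y 0 k; set b := fun k => y 0 k - z 0 k.
have -> : \sum_k (x 0 k - z 0 k) ^+ 2 =
    \sum_k a k ^+ 2 + (\sum_k a k * b k) *+ 2 + \sum_k b k ^+ 2.
  rewrite -mulr_natl mulr_sumr -!big_split; apply: eq_bigr => k _ /=.
  by rewrite /a /b; ring.
by rewrite lerD2r lerD2l lerMn2r/= cauchy_schwarz_sum.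
Qed.

Lemma coord_le_edist x y k : `|x 0 k - y 0 k| <= edist x y.
Proof.
rewrite -sqrtr_sqr /edist ler_sqrt ?sqr_sum_ge0//.
rewrite (bigD1 k)//= lerDl; apply: sumr_ge0 => i _; exact: sqr_ge0.
Qed.

Lemma edist_le_coord x y e : 0 <= e -> (forall k, `|x 0 k - y 0 k| <= e) ->
  edist x y <= d%:R * e.
Proof.
move=> e0 h; have de : 0 <= d%:R * e by rewrite mulr_ge0.
rewrite -[leRHS]ger0_norm// -sqrtr_sqr ler_sqrt ?sqr_ge0//.
apply: (@le_trans _ _ (\sum_(k < d) e ^+ 2)).
  apply: ler_sum => k _.
  by rewrite -[leLHS]real_normK ?num_real// lerXn2r ?nnegrE ?h.
rewrite sumr_const card_ord -[leLHS]mulr_natl exprMn; apply: ler_wpM2r.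
  exact: sqr_ge0.
by rewrite -natrX ler_nat; case: (d) => // n; rewrite leq_pmulr.
Qed.

Lemma edist_eq0 x y : edist x y = 0 -> x = y.
Proof.
move=> xy; apply/rowP => k; apply/eqP; rewrite -subr_eq0 -normr_le0 -xy.
exact: coord_le_edist.
Qed.

(** The bridge between the topology of the sup norm and Euclidean balls; the topological facts below
    pass through it. *)
Lemma nbhs_edist x (P : set 'rV[R]_d) :
  nbhs x P <-> exists2 e : R, 0 < e & forall y, edist x y < e -> P y.
Proof.
split=> [/nbhs_ballP[e /= e0 xeP]|[e e0 xeP]].
  exists e => // y xy; apply: xeP; split=> // i j; rewrite [i]ord1.
  by rewrite /ball/= (le_lt_trans _ xy)// coord_le_edist.
(* Dividing by d + 1 instead of d covers d = 0 and makes the final inequality strict. *)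
apply/nbhs_ballP; exists (e / d.+1%:R) => /=; first by rewrite divr_gt0.
move=> y [_ xy]; apply: xeP.
have e1 : 0 <= e / d.+1%:R by rewrite divr_ge0// ltW.
apply: le_lt_trans (edist_le_coord e1 _) _.
  by move=> k; apply/ltW/xy.
by rewrite mulrCA gtr_pMr// ltr_pdivrMr// mul1r ltr_nat.
Qed.

Lemma closure_edist A x e : 0 < e -> closure A x ->
  exists2 y, A y & edist x y < e.
Proof.
move=> e0 /(_ [set y | edist x y < e])[|y [Ay xy]]; last by exists y.
by apply/nbhs_edist; exists e.
Qed.

Lemma open_thickening A e : open [set y | exists2 x, A x & edist x y < e].
Proof.
rewrite openE => y [x Ax xy]; apply/nbhs_edist.
exists (e - edist x y) => [|z yz]; first by rewrite subr_gt0.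
by exists x => //; apply: le_lt_trans (edist_triangle y _ _) _; rewrite -ltrBrDl.
Qed.

Lemma lipschitz_continuous (f : 'rV[R]_d -> 'rV[R]_d) (c : R) :
  0 < c -> (forall x y, edist (f x) (f y) <= c * edist x y) -> continuous f.
Proof.
move=> c0 fc x P /nbhs_edist[e e0 xP]; apply/nbhs_edist.
exists (e / c) => [|y xy]; first by rewrite divr_gt0.
by apply: xP; rewrite (le_lt_trans (fc _ _))// mulrC -ltr_pdivlMr.
Qed.

Lemma compact_closed_rV K : compact K -> closure K `<=` K.
Proof. by move=> cK; exact: (compact_closed (@norm_hausdorff _ _) cK). Qed.

Lemma edist_continuous : continuous (fun p : 'rV[R]_d * 'rV[R]_d => edist p.1 p.2).
Proof.
move=> [x y] /=; apply/cvgrPdist_lt => e e0.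
have e2 : 0 < e / 2 by rewrite divr_gt0.
exists ([set z | edist x z < e / 2], [set z | edist y z < e / 2]).
  by split; apply/nbhs_edist; exists (e / 2).
move=> [u v] [/= xu yv].
have h1 := edist_triangle u x y; have h2 := edist_triangle v u y.
have h3 := edist_triangle x u v; have h4 := edist_triangle y x v.
move: h1 h2 h3 h4; rewrite (edistC v y) (edistC u x).
by rewrite ltr_distlC => *; apply/andP; split; lra.
Qed.

Lemma compact_bounded K : compact K ->
  exists2 D : R, 0 < D & forall x y, K x -> K y -> edist x y <= D.
Proof.
move=> cK; have [->|/set0P[x0 Kx0]] := eqVneq K set0; first by exists 1.
have K2 : (K `*` K) !=set0 by exists (x0, x0).
have [p _ pmax] := compact_EVT_max K2 (compact_setX cK cK)
  (continuous_subspaceT edist_continuous).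
exists (edist p.1 p.2 + 1) => [|x y Kx Ky].
  by rewrite ltr_wpDl// edist_ge0.
apply: (@le_trans _ _ (edist p.1 p.2)); last by rewrite lerDl.
by apply: (pmax (x, y)); rewrite inE.
Qed.

Lemma compact_disjoint_gap A B : compact A -> compact B -> A `&` B = set0 ->
  exists2 e : R, 0 < e & forall x y, A x -> B y -> e <= edist x y.
Proof.
move=> cA cB AB; have [[p []]|] := pselect ((A `*` B) !=set0); last first.
  move=> AB0; exists 1 => // x y Ax By; exfalso; apply: AB0; exists (x, y); split=> //.
move=> Ap Bp; have AB0 : (A `*` B) !=set0 by exists p.
have [q] := compact_EVT_min AB0 (compact_setX cA cB)
  (continuous_subspaceT edist_continuous).
rewrite inE => -[Aq Bq] qmin; exists (edist q.1 q.2) => [|x y Ax By].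
  rewrite lt_def edist_ge0 andbT; apply/eqP => /edist_eq0 qq.
  by have : (A `&` B) q.1; [split=> //; rewrite qq|rewrite AB].
by apply: (qmin (x, y)); rewrite inE.
Qed.

End Euclidean.

(** * Sets of Hausdorff measure zero *)

Section Series.
Context {R : realType}.
Local Open Scope ereal_scope.

Lemma nneseries_le (a : nat -> \bar R) (B : \bar R) : (forall n, 0 <= a n) ->
  (forall n, \sum_(0 <= i < n) a i <= B) -> \sum_(i <oo) a i <= B.
Proof.
move=> a0 aB; apply: lime_le; first exact: is_cvg_nneseries.
by near=> n; exact: aB.
Unshelve. all: by end_near. Qed.

(** Lets covers be indexed by any countable type: codes without preimage contribute 0, and only
    finite duplicate-free subfamilies have to be estimated. *)
Lemma nneseries_count (I : countType) (a : I -> \bar R) (B : \bar R) :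
  (forall i, 0 <= a i) ->
  (forall s : seq I, uniq s -> \sum_(i <- s) a i <= B) ->
  \sum_(j <oo) oapp a 0 (pickle_inv j) <= B.
Proof.
move=> a0 aB; apply: nneseries_le => [n|n]; first by case: pickle_inv => /=.
by rewrite -big_pmap aB// (pmap_uniq (@pickle_invK I))// iota_uniq.
Qed.

Lemma sum_uniq_le_nneseries (a : nat -> \bar R) (s : seq nat) :
  (forall i, 0 <= a i) -> uniq s -> \sum_(i <- s) a i <= \sum_(i <oo) a i.
Proof.
move=> a0 us; set n := (\max_(i <- s) i).+1.
apply: (@le_trans _ _ (\sum_(0 <= i < n) a i)); last exact: nneseries_lim_ge.
have sn : {subset s <= index_iota 0 n}.
  by move=> i si; rewrite mem_index_iota/= /n ltnS; exact: leq_bigmax_seq.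
rewrite [leRHS](bigID (mem s) xpredT)/= -[leLHS]adde0.
apply: leeD; last exact: sume_ge0.
rewrite -[leRHS]big_filter le_eqVlt; apply/orP; left; apply/eqP; apply: perm_big.
apply: uniq_perm => //; first by rewrite filter_uniq// iota_uniq.
by move=> i; rewrite mem_filter; case: (boolP (i \in s)) => //= /sn ->.
Qed.

End Series.

Section Powers.
Context {R : realType}.
Implicit Types (t x e : R).

Lemma poweR_le_root t (x : \bar R) e : 0 < t -> (0 <= x)%E -> 0 <= e ->
  (x `^ t <= (e `^ t)%:E)%E -> (x <= e%:E)%E.
Proof.
move=> t0; case: x => [x| |] //.
  2: by move=> _ _; rewrite poweRyr ?gt_eqF// leye_eq.
rewrite poweR_EFin !lee_fin => x0 e0 xe; rewrite leNgt; apply/negP => ex.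
by move: xe; rewrite leNgt gt0_ltr_powR ?nnegrE// ltW.
Qed.

Lemma powR_right_continuous t x e : 0 < t -> 0 <= x -> 0 < e ->
  exists2 h, 0 < h & (x + h) `^ t <= x `^ t + e.
Proof.
move=> t0 x0 e0; set y := (x `^ t + e) `^ t^-1.
have xe0 : 0 <= x `^ t + e by rewrite addr_ge0 ?powR_ge0// ltW.
have yt : y `^ t = x `^ t + e by rewrite -powRrM mulVf ?gt_eqF// powRr1.
exists (y - x); last by rewrite addrCA subrr addr0 yt.
rewrite subr_gt0 ltNge; apply/negP => yx.
have : y `^ t <= x `^ t by rewrite (ge0_ler_powR (ltW t0)) ?nnegrE ?powR_ge0.
by rewrite yt gerDl leNgt e0.
Qed.

Lemma powR_arbitrarily_small t e : 0 < t -> 0 < e ->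
  exists2 h, 0 < h & h `^ t <= e.
Proof.
move=> t0 e0; have [h h0 he] := powR_right_continuous t0 (lexx 0) e0.
by exists h => //; rewrite add0r powR0 ?gt_eqF// add0r in he.
Qed.

Lemma geometric_sum_le1 n : \sum_(j < n) (2^-1 : R) ^+ j.+1 <= 1.
Proof.
suff -> : \sum_(j < n) (2^-1 : R) ^+ j.+1 = 1 - 2^-1 ^+ n.
  by rewrite gerBl exprn_ge0.
elim: n => [|n ih]; first by rewrite big_ord0 expr0 subrr.
by rewrite big_ord_recr/= ih exprS; lra.
Qed.

End Powers.

Section Diameter.
Context {R : realType} {d : nat}.
Implicit Types (A B : set 'rV[R]_d).
Local Open Scope ereal_scope.

Lemma diam_ge0 A : 0 <= diam A.
Proof. by apply: ereal_sup_ubound; left. Qed.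

Lemma edist_le_diam A x y : A x -> A y -> (edist x y)%:E <= diam A.
Proof. by move=> Ax Ay; apply: ereal_sup_ubound; right; exists x => //; exists y. Qed.

Lemma diam_leP A (r : \bar R) : 0 <= r ->
  (diam A <= r <-> forall x y, A x -> A y -> (edist x y)%:E <= r).
Proof.
move=> r0; split=> [Ar x y Ax Ay|Ar].
  by apply: le_trans Ar; exact: edist_le_diam.
by apply: ge_ereal_sup => _ [->//|[x Ax [y Ay <-]]]; exact: Ar.
Qed.

Lemma diam0 : diam (set0 : set 'rV[R]_d) = 0.
Proof. by apply: le_anti; rewrite diam_ge0 andbT; apply/diam_leP. Qed.

Lemma poweR_diam0 t : (0 < t)%R -> diam (set0 : set 'rV[R]_d) `^ t = 0.
Proof. by move=> t0; rewrite diam0 poweR0r// gt_eqF. Qed.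

Lemma diam_poweR_le A (c t : R) (e : \bar R) : (0 <= t)%R -> (0 <= c)%R ->
  0 <= e -> (forall x y, A x -> A y -> (edist x y)%:E <= c%:E * e) ->
  diam A `^ t <= (c `^ t)%:E * e `^ t.
Proof.
move=> t0 c0 e0 h; rewrite -poweR_EFin -poweRM// gt0_ler_poweR//.
- by rewrite in_itv/= diam_ge0 leey.
- by rewrite in_itv/= mule_ge0//= leey.
- by apply/diam_leP => //; rewrite mule_ge0.
Qed.

End Diameter.

Section HausdorffNull.
Context {R : realType} {d : nat}.
Implicit Types (A F K : set 'rV[R]_d) (t u c e : R).

(** No mesh size appears: for t > 0 a small sum already forces every diameter to be small, which is
    why [hnullP] holds. *)
Definition hnull t F := forall e, 0 < e ->
  exists2 U : nat -> set 'rV[R]_d, F `<=` \bigcup_j U j &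
    (\sum_(j <oo) diam (U j) `^ t <= e%:E)%E.

Lemma hnullP t F : 0 < t -> hausdorff_measure t F = 0%E <-> hnull t F.
Proof.
move=> t0; have content_ge0 delta : (0 <= hausdorff_content t delta F)%E.
  apply: le_ereal_inf_tmp => _ [U _ <-].
  by apply: nneseries_ge0 => *; exact: poweR_ge0.
split=> [F0 e e0|nF].
  have : (hausdorff_content t 1 F < e%:E)%E.
    apply: (@le_lt_trans _ _ 0%E); last by rewrite lte_fin.
    by rewrite -F0; apply: ereal_sup_ubound; exists 1 => //=.
  by move=> /ereal_inf_lt[_ [U [FU _] <-]] /ltW Ue; exists U.
apply/eqP; rewrite eq_le; apply/andP; split.
  apply: ge_ereal_sup => _ [delta /= delta0 <-].
  apply/lee_addgt0Pr => e e0; rewrite add0e.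
  have [|U FU Ue] := nF (Num.min e (delta `^ t)).
    by rewrite lt_min e0 powR_gt0.
  apply: (@le_trans _ _ (\sum_(j <oo) diam (U j) `^ t)%E); last first.
    by apply: le_trans Ue _; rewrite lee_fin ge_min lexx.
  apply: ereal_inf_lbound; exists U => //; split=> // j.
  apply: (poweR_le_root t0) (diam_ge0 _) (ltW delta0) _.
  have : (diam (U j) `^ t <= \sum_(j <oo) diam (U j) `^ t)%E.
    have /= := @sum_uniq_le_nneseries R (fun j => diam (U j) `^ t)%E [:: j].
    by rewrite big_seq1; apply => // i; exact: poweR_ge0.
  by move/le_trans => -> //; apply: le_trans Ue _; rewrite lee_fin ge_min lexx orbT.
apply: le_trans (content_ge0 1) _.
by apply: ereal_sup_ubound; exists 1 => //=.
Qed.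

Lemma hnull_count t F : 0 < t ->
  (forall e, 0 < e -> exists (I : countType) (U : I -> set 'rV[R]_d),
    F `<=` \bigcup_i U i /\
    forall s : seq I, uniq s -> (\sum_(i <- s) diam (U i) `^ t <= e%:E)%E) ->
  hnull t F.
Proof.
move=> t0 h e /h[I [U [FU Ue]]].
exists (fun j => oapp U set0 (pickle_inv j)).
  by move=> x /FU[i _ Uix]; exists (pickle i) => //=; rewrite pickleK_inv.
have := nneseries_count (fun i => poweR_ge0 (diam (U i)) t) Ue.
congr (_ <= _)%E; congr (limn _); apply/funext => n; apply: eq_bigr => j _.
by case: pickle_inv => //=; rewrite poweR_diam0.
Qed.

Lemma hnull_exponent u t F : 0 < u -> u <= t -> hnull u F -> hnull t F.
Proof.
(* Capping the sum by 1 makes every diameter at most 1, where a larger exponent gives a smaller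
   power. *)
move=> u0 ut nF e e0; have [|U FU Ue] := nF (Num.min e 1).
  by rewrite lt_min e0 ltr01.
exists U => //; apply: (@le_trans _ _ (\sum_(j <oo) diam (U j) `^ u)%E); last first.
  by apply: le_trans Ue _; rewrite lee_fin ge_min lexx.
apply: lee_nneseries => [j _ _|j _]; first exact: poweR_ge0.
have : (diam (U j) <= 1%:E)%E.
  apply: (poweR_le_root u0) (diam_ge0 _) ler01 _; rewrite powR1.
  apply: (@le_trans _ _ (\sum_(j <oo) diam (U j) `^ u)%E).
    have /= := @sum_uniq_le_nneseries R (fun j => diam (U j) `^ u)%E [:: j].
    by rewrite big_seq1; apply => // i; exact: poweR_ge0.
  by apply: le_trans Ue _; rewrite lee_fin ge_min lexx orbT.
have := diam_ge0 (U j); case: (diam (U j)) => [x| |] //.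
rewrite !lee_fin => x0 x1; have t0 := lt_le_trans u0 ut.
have [->|xn0] := eqVneq x 0.
  by rewrite !powR0 ?gt_eqF.
by apply: ger_powR => //; rewrite lt_def xn0 x0 x1.
Qed.

Lemma hnull_expanding t c (f : 'rV[R]_d -> 'rV[R]_d) F K : 0 < t -> 0 < c ->
  (forall x y, c * edist x y <= edist (f x) (f y)) -> f @` F `<=` K ->
  hnull t K -> hnull t F.
Proof.
move=> t0 c0 fc fFK nK e e0; have ct : 0 < c `^ t by rewrite powR_gt0.
have [|U KU Ue] := nK (c `^ t * e); first by rewrite mulr_gt0.
exists (fun j => f @^-1` U j).
  by move=> x Fx; have [|j _ Ujx] := KU (f x); [apply: fFK; exists x|exists j].
apply: (@le_trans _ _ (\sum_(j <oo) (((c `^ t)^-1)%:E * diam (U j) `^ t))%E).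
  apply: lee_nneseries => [j _ _|j _]; first exact: poweR_ge0.
  have -> : (c `^ t)^-1 = c^-1 `^ t.
    by rewrite -(powR_inv1 (ltW c0)) -powRrM mulN1r powRN.
  apply: diam_poweR_le => [|||x y Ux Uy].
  - exact: ltW.
  - by rewrite invr_ge0 ltW.
  - exact: diam_ge0.
  - apply: (@le_trans _ _ (c^-1%:E * (edist (f x) (f y))%:E)%E).
      by rewrite -EFinM lee_fin ler_pdivlMl.
    by rewrite lee_pmul2l ?lte_fin ?invr_gt0// edist_le_diam.
rewrite nneseriesZl => [|j _]; last exact: poweR_ge0.
rewrite -(@lee_pmul2l _ (c `^ t)%:E)// muleA -EFinM mulfV ?gt_eqF// mul1e.
by rewrite -EFinM.
Qed.

(** The sets are thickened to open ones at an extra cost of at most e/2 in total, then compactness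
    applies. Each set carries a bound for its diameter instead of the diameter itself, so that
    rescaling a cover acts on the pairs directly. *)
Lemma hnull_finite_cover t K e : 0 < t -> compact K -> hnull t K -> 0 < e ->
  exists l : seq (set 'rV[R]_d * R),
    [/\ forall x, K x -> exists2 p, p \in l & p.1 x,
        forall p, p \in l -> 0 <= p.2 /\
          forall x y, p.1 x -> p.1 y -> edist x y <= p.2
      & \sum_(p <- l) p.2 `^ t <= e].
Proof.
move=> t0 cK nK e0; have e2 : 0 < e / 2 by rewrite divr_gt0.
have [U KU Ue] := nK _ e2.
have Uj j : (diam (U j) `^ t <= (e / 2)%:E)%E.
  apply: le_trans Ue.
  have /= := @sum_uniq_le_nneseries R (fun j => diam (U j) `^ t)%E [:: j].
  by rewrite big_seq1; apply => // i; exact: poweR_ge0.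
have Ufin j : diam (U j) = (fine (diam (U j)))%:E.
  rewrite fineK// ge0_fin_numE ?diam_ge0//.
  by apply: (lty_poweRy (r := t)); [rewrite gt_eqF|exact: le_lt_trans (Uj j) (ltry _)].
pose b j := fine (diam (U j)).
have b0 j : 0 <= b j by rewrite fine_ge0// diam_ge0.
have /choice[h hP] j : exists h, 0 < h /\
    (b j + h) `^ t <= b j `^ t + e / 2 * 2^-1 ^+ j.+1.
  have [|h h0 hh] := powR_right_continuous (e := e / 2 * 2^-1 ^+ j.+1) t0 (b0 j).
    by rewrite mulr_gt0// exprn_gt0.
  by exists h.
(* Thickening by [h j / 2] on both sides raises the diameter bound from [b j] to [b j + h j]. *)
pose W j := [set y | exists2 x, U j x & edist x y < h j / 2].
move: (cK); rewrite compact_cover => /(_ nat setT W)[j _||D _ KD].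
- exact: open_thickening.
- move=> x /KU[j _ Ujx]; exists j => //; exists x => //.
  by rewrite edistxx divr_gt0//; case: (hP j).
set n := (\max_(i <- finmap.enum_fset D) i).+1.
exists [seq (W j, b j + h j) | j <- iota 0 n]; split.
- move=> x /KD[j jD Wx]; exists (W j, b j + h j); last exact: Wx.
  apply: (map_f (fun j => (W j, b j + h j))).
  by rewrite mem_iota add0n ltnS; exact: leq_bigmax_seq.
- move=> _ /mapP[j _ ->] /=; have [hj _] := hP j.
  split=> [|x y [x' Ux xx'] [y' Uy yy']]; first by rewrite addr_ge0// ltW.
  have := edist_le_diam Ux Uy; rewrite Ufin lee_fin -/(b j).
  have := edist_triangle x' x y; have := edist_triangle y' x' y.
  by rewrite (edistC x x'); lra.
- rewrite big_map.
  apply: (@le_trans _ _ (\sum_(j <- iota 0 n) (b j `^ t + e / 2 * 2^-1 ^+ j.+1))).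
    by apply: ler_sum => j _; case: (hP j).
  rewrite big_split/= [leRHS]splitr; apply: lerD.
    rewrite -lee_fin -sumEFin; apply: le_trans Ue.
    rewrite (eq_bigr (fun j => diam (U j) `^ t)%E) => [|j _].
      apply: (@sum_uniq_le_nneseries R (fun j => diam (U j) `^ t)%E) => [i|].
        exact: poweR_ge0.
      exact: (iota_uniq 0 n).
    by rewrite Ufin poweR_EFin.
  rewrite -mulr_sumr -[leRHS]mulr1; apply: (ler_wpM2l (ltW e2)).
  have := @geometric_sum_le1 R n.
  by rewrite -(big_mkord xpredT (fun j => 2^-1 ^+ j.+1)) /index_iota subn0.
Qed.

End HausdorffNull.

(** * Disjoint similar copies *)

Lemma fin_lower_bound {R : realType} (I : finType) (h : I -> R) :
  (forall i, 0 < h i) -> exists2 e, 0 < e & forall i, e <= h i.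
Proof.
move=> h0; exists (\big[Order.min/1]_i h i); first exact: lt_bigmin.
by move=> i; exact: bigmin_le_cond.
Qed.

Lemma powR_exponent {R : realType} (k q : R) : 0 < k < 1 -> 0 < q < 1 ->
  exists2 h, 0 < h & k `^ h = q.
Proof.
move=> /andP[k0 k1] /andP[q0 q1]; exists (ln q / ln k).
  by rewrite nmulr_rgt0 ?invr_lt0 ln_lt0// ?k0 ?k1 ?q0 ?q1.
by rewrite /powR gt_eqF// mulfVK ?lt_eqF ?ln_lt0 ?k0// lnK.
Qed.

Section Copies.
Context {R : realType} {d : nat}.
Implicit Types (E : set 'rV[R]_d) (c t r : R) (f : 'rV[R]_d -> 'rV[R]_d).

(** The ratio is explicit and not assumed below 1: the empty path yields the identity. For copies
    inside a compact set with two points, [copy_ratio_le1] supplies the bound. *)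
Definition similarity c f :=
  0 < c /\ forall x y, edist (f x) (f y) = c * edist x y.

Lemma similarity_continuous c f : similarity c f -> continuous f.
Proof. by move=> [c0 fc]; apply: (lipschitz_continuous c0) => x y; rewrite fc. Qed.

Lemma similarity_id : similarity 1 id.
Proof. by split=> // x y; rewrite mul1r. Qed.

Lemma similarity_comp c c' f f' :
  similarity c f -> similarity c' f' -> similarity (c * c') (f \o f').
Proof.
by move=> [c0 fc] [c0' fc']; split=> [|x y]; rewrite ?mulr_gt0//= fc fc' mulrA.
Qed.

Lemma similarity_compact E c f : similarity c f -> compact E -> compact (f @` E).
Proof.
move=> /similarity_continuous fc cE; apply: continuous_compact cE.
exact: continuous_subspaceT.
Qed.

Definition disjoint_copies E (I : finType) (c : I -> R)
    (f : I -> 'rV[R]_d -> 'rV[R]_d) :=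
  [/\ forall i, similarity (c i) (f i), forall i, f i @` E `<=` E &
      forall i j, i != j -> f i @` E `&` f j @` E = set0].

(* In a finite cover, a set meeting two copies has diameter at least the gap
   [eta]; if there is none, the cover splits into covers of the single copies
   and each of these, rescaled, is a cover of E by fewer sets. *)
Lemma separated_copies_not_hnull E (I : finType) (c : I -> R)
    (f : I -> 'rV[R]_d -> 'rV[R]_d) t (i0 i1 : I) :
  0 < t -> compact E -> E !=set0 -> disjoint_copies E c f -> i0 != i1 ->
  1 <= \sum_i c i `^ t -> ~ hnull t E.
Proof.
move=> t0 cE [z Ez] [simf fE disj] i01 sum1 nE.
have [eta eta0 gap] : exists2 eta : R, 0 < eta & forall i j x y, i != j ->
    E x -> E y -> eta <= edist (f i x) (f j y).
  have /choice[h hP] (p : I * I) : exists h : R, 0 < h /\ (p.1 != p.2 ->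
      forall x y, E x -> E y -> h <= edist (f p.1 x) (f p.2 y)).
    have [eqp|neqp] := eqVneq p.1 p.2; first by exists 1.
    have [h h0 hP] := compact_disjoint_gap (similarity_compact (simf p.1) cE)
      (similarity_compact (simf p.2) cE) (disj _ _ neqp).
    exists h; split=> // _ x y Ex Ey; apply: hP; [by exists x|by exists y].
  have [e e0 eh] := fin_lower_bound (fun p => (hP p).1).
  exists e => // i j x y ij Ex Ey.
  exact: le_trans (eh (i, j)) ((hP (i, j)).2 ij x y Ex Ey).
have main n (l : seq (set 'rV[R]_d * R)) : (size l <= n)%N ->
    (forall x, E x -> exists2 p, p \in l & p.1 x) ->
    (forall p, p \in l -> 0 <= p.2 /\
      forall x y, p.1 x -> p.1 y -> edist x y <= p.2) ->
    eta `^ t <= \sum_(p <- l) p.2 `^ t.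
  elim: n l => [|n ih] l.
    by rewrite leqn0 size_eq0 => /eqP -> /(_ z Ez)[].
  move=> ln lE lb.
  pose meets i (p : set 'rV[R]_d * R) := `[< exists2 x, E x & p.1 (f i x) >].
  have [[p [i [j [pl ij mi mj]]]]|none] := pselect (exists p i j,
      [/\ p \in l, i != j, meets i p & meets j p]).
    move: mi mj => /asboolP[x Ex pix] /asboolP[y Ey piy].
    have [p0 pd] := lb _ pl.
    apply: (@le_trans _ _ (p.2 `^ t)).
      apply: (ge0_ler_powR (ltW t0)); rewrite ?nnegrE ?(ltW eta0)//.
      exact: le_trans (gap _ _ _ _ ij Ex Ey) (pd _ _ pix piy).
    rewrite (big_rem p pl)/= lerDl; apply: sumr_ge0 => *; exact: powR_ge0.
  have sub i : eta `^ t * c i `^ t <= \sum_(p <- l | meets i p) p.2 `^ t.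
    have [ci0 fci] := simf i.
    have := ih [seq (f i @^-1` p.1, p.2 / c i) | p <- l & meets i p].
    rewrite big_map big_filter => h.
    have -> : \sum_(p <- l | meets i p) p.2 `^ t =
        (\sum_(p <- l | meets i p) (p.2 / c i) `^ t) * c i `^ t.
      rewrite mulr_suml big_seq_cond [RHS]big_seq_cond; apply: eq_bigr => p /andP[pl _].
      have [p0 _] := lb _ pl.
      have pc0 : 0 <= p.2 / c i by rewrite divr_ge0// ltW.
      by rewrite -(powRM t pc0 (ltW ci0)) divfK// gt_eqF.
    rewrite ler_wpM2r ?powR_ge0//; apply: h.
    (* The cover of copy [i] has fewer sets: one containing [f j z], with j different from i, cannot
       meet copy [i] as well. *)
    - rewrite size_map size_filter -ltnS; apply: leq_trans ln.
      rewrite -(count_predC (meets i) l) -[X in (X < _)%N]addn0 ltn_add2l -has_count.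
      have [j ij] : exists j, i != j.
        by have [ii0|] := eqVneq i i0; [exists i1; rewrite ii0|exists i0].
      have [p pl pjz] : exists2 p, p \in l & p.1 (f j z).
        by apply: lE; apply: fE; exists z.
      apply/hasP; exists p => //=; apply/negP => mi; apply: none.
      exists p, i, j; split=> //; apply/asboolP; exists z => //.
    - move=> x Ex; have [p pl px] : exists2 p, p \in l & p.1 (f i x).
        by apply: lE; apply: (fE i); exists x.
      exists (f i @^-1` p.1, p.2 / c i) => //.
      apply: (map_f (fun p => (f i @^-1` p.1, p.2 / c i))).
      by rewrite mem_filter pl andbT; apply/asboolP; exists x.
    - move=> _ /mapP[p + ->]; rewrite mem_filter => /andP[_ pl] /=.
      have [p0 pd] := lb _ pl; split=> [|x y px py]; first by rewrite divr_ge0// ltW.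
      by rewrite ler_pdivlMr// mulrC -fci; exact: pd.
  apply: (@le_trans _ _ (\sum_i eta `^ t * c i `^ t)).
    by rewrite -mulr_sumr ler_peMr// powR_ge0.
  apply: (@le_trans _ _ (\sum_i \sum_(p <- l | meets i p) p.2 `^ t)).
    by apply: ler_sum => i _; exact: sub.
  under eq_bigr do rewrite big_mkcond/=.
  (* No set meets two copies, so the double sum counts each set at most once. *)
  rewrite exchange_big/= big_seq [leRHS]big_seq; apply: ler_sum => p pl.
  rewrite -big_mkcond/=.
  have [i mi|nom] := pickP (meets^~ p); last by rewrite big_pred0// powR_ge0.
  rewrite (big_pred1 i)// => j /=; apply/idP/eqP => [mj|->//].
  by apply/eqP; apply/negPn/negP => ji; apply: none; exists p, j, i.
have eta_t : 0 < eta `^ t by rewrite powR_gt0.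
have e2 : 0 < eta `^ t / 2 by rewrite divr_gt0.
have [l [lE lb le]] := hnull_finite_cover t0 cE nE e2.
by have := main _ l (leqnn _) lE lb; rewrite leNgt => /negP; apply; lra.
Qed.

(** A pair of points of [E] at maximal distance is mapped to a pair of points of [E] at [c] times
    that distance. *)
Lemma copy_ratio_le1 E c f p q : compact E -> E p -> E q -> p != q ->
  similarity c f -> f @` E `<=` E -> c <= 1.
Proof.
move=> cE Ep Eq pq [c0 fc] fE.
have E2 : (E `*` E) !=set0 by exists (p, q).
have [u] := compact_EVT_max E2 (compact_setX cE cE)
  (continuous_subspaceT edist_continuous).
rewrite inE => -[Eu1 Eu2] umax.
have max_edist x y : E x -> E y -> edist x y <= edist u.1 u.2.
  by move=> Ex Ey; apply: (umax (x, y)); rewrite inE.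
have pos : 0 < edist u.1 u.2.
  apply: lt_le_trans (max_edist _ _ Ep Eq).
  by rewrite lt_def edist_ge0 andbT; apply: contra pq => /eqP/edist_eq0 ->.
rewrite -(ler_pM2r pos) mul1r -fc; apply: max_edist; apply: fE.
  by exists u.1.
by exists u.2.
Qed.

(** The statement that the Hausdorff dimension is s > 0, leaving open whether [E] is null for the
    exponent s itself. *)
Definition critical_exponent E (s : R) :=
  0 < s /\ forall t, 0 < t -> (hnull t E -> s <= t) /\ (s < t -> hnull t E).

(** If the sum exceeded 1, there would be room to raise the exponent to s + h with the sum still at
    least 1; then [E] would not be null for s + h, which lies above the critical exponent. *)
Lemma sum_copies_le1 E (s : R) (I : finType) (c : I -> R)
    (f : I -> 'rV[R]_d -> 'rV[R]_d) p q :
  compact E -> E p -> E q -> p != q -> critical_exponent E s ->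
  disjoint_copies E c f -> \sum_i c i `^ s <= 1.
Proof.
move=> cE Ep Eq pq [s0 crit] copies; have [simf fE _] := copies.
have c0 i : 0 < c i by case: (simf i).
have c1 i : c i <= 1 := copy_ratio_le1 cE Ep Eq pq (simf i) (@fE i).
rewrite leNgt; apply/negP => sum1.
(* A single copy has ratio at most 1, so a sum above 1 needs two indices. *)
have [i0 [i1 i01]] : exists i0 i1 : I, i0 != i1.
  apply: contrapT => none; move: sum1; apply/negP; rewrite -leNgt.
  have [i _|I0] := pickP (@predT I); last by rewrite big_pred0.
  rewrite (big_pred1 i) => [|j /=]; last first.
    by apply/esym/eqP/eqP/negPn/negP => ji; apply: none; exists j, i.
  have <- : 1 `^ s = 1 by rewrite powR1.
  by apply: (ge0_ler_powR (ltW s0)); rewrite ?nnegrE// ltW.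
have [k k0 kc] := fin_lower_bound c0.
(* All ratios are at least [k / 2], and halving makes this base less than 1, so some power [h] of it
   equals the inverse of the sum. *)
have kk : 0 < k / 2 < 1.
  by rewrite divr_gt0//= ltr_pdivrMr//; have := kc i0; have := c1 i0; lra.
have S0 : 0 < \sum_i c i `^ s by apply: lt_trans sum1.
have q01 : 0 < (\sum_i c i `^ s)^-1 < 1 by rewrite invr_gt0 S0 invf_lt1.
have [h h0 hk] := powR_exponent kk q01.
have sh : 0 < s + h by rewrite addr_gt0.
have E0 : E !=set0 by exists p.
apply: (separated_copies_not_hnull sh cE E0 copies i01); last first.
  by apply: (crit _ sh).2; rewrite ltrDl.
rewrite -(mulVf (lt0r_neq0 S0)) -hk mulr_sumr; apply: ler_sum => i _.
rewrite mulrC powRD; last by rewrite (gt_eqF (c0 i)) implybT.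
apply: ler_wpM2l; first exact: powR_ge0.
apply: (ge0_ler_powR (ltW h0)); rewrite ?nnegrE ?divr_ge0 ?ltW//.
by have := kc i; lra.
Qed.

End Copies.

(** * Critical exponent and packing sums *)

Section CriticalExponent.
Context {R : realType} {d : nat}.
Implicit Types (E F : set 'rV[R]_d) (c t r s : R) (f : 'rV[R]_d -> 'rV[R]_d).

(** [a] depends on [r0]: copies inside a compact set with two points have ratio at most 1, so no [a]
    serves for arbitrarily large radii. *)
Definition quasi_self_similar E := forall r0 : R, 0 < r0 ->
  exists2 a : R, 0 < a & forall x r, E x -> 0 < r <= r0 ->
    exists c f, [/\ similarity c f, a * r <= c &
      forall y, E y -> E (f y) /\ edist x (f y) <= r].

Lemma edist_gt0 (p q : 'rV[R]_d) : p != q -> 0 < edist p q.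
Proof.
by move=> pq; rewrite lt_def edist_ge0 andbT; apply: contra pq => /eqP/edist_eq0 ->.
Qed.

Lemma exists_not_hnull E p q : compact E -> E p -> E q -> p != q ->
  quasi_self_similar E -> exists2 h, 0 < h & ~ hnull h E.
Proof.
move=> cE Ep Eq pq qE; have pq0 := edist_gt0 pq.
have e0 : 0 < edist p q / 3 by rewrite divr_gt0.
have [a a0 qa] := qE _ e0.
have er : 0 < edist p q / 3 <= edist p q / 3 by rewrite e0 lexx.
have [c1 [f1 [sim1 ac1 fE1]]] := qa p _ Ep er.
have [c2 [f2 [sim2 ac2 fE2]]] := qa q _ Eq er.
set k := Num.min (a * (edist p q / 3)) 2^-1.
have k01 : 0 < k < 1.
  by rewrite lt_min mulr_gt0//= gt_min invr_gt0 ltr0n/= invf_lt1// ltr1n orbT.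
have half : 0 < (2^-1 : R) < 1 by rewrite invr_gt0 ltr0n/= invf_lt1// ltr1n.
have [h h0 hk] := powR_exponent k01 half.
exists h => //.
pose c b := if b then c1 else c2; pose f b := if b then f1 else f2.
have disj : f1 @` E `&` f2 @` E = set0.
  rewrite -subset0 => _ [[x Ex <-] [y Ey yx]].
  have [_ h1] := fE1 _ Ex; have [_] := fE2 _ Ey; rewrite yx => h2.
  exfalso; have := edist_triangle (f1 x) p q; rewrite (edistC (f1 x) q); lra.
have copies : disjoint_copies E c f.
  split=> [[]//|[] _ [x Ex <-]|[] []//= _].
  - by case: (fE1 _ Ex).
  - by case: (fE2 _ Ex).
  - by rewrite setIC.
apply: (separated_copies_not_hnull h0 cE _ copies (i0 := true) (i1 := false)) => //.
  by exists p.
have kk : 0 <= k by case/andP: k01 => /ltW.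
have kc b : 2^-1 <= c b `^ h.
  rewrite -hk; apply: (ge0_ler_powR (ltW h0)); rewrite ?nnegrE//.
    by rewrite /c; case: b; apply: ltW; [case: sim1|case: sim2].
  by rewrite /k ge_min /c; case: b; rewrite ?ac1 ?ac2.
move: (kc true) (kc false); rewrite big_bool /=; lra.
Qed.

Lemma critical_exponent_exists E p q t : compact E -> E p -> E q -> p != q ->
  quasi_self_similar E -> 0 < t -> hnull t E -> exists s, critical_exponent E s.
Proof.
move=> cE Ep Eq pq qE t0 nt.
have [h h0 nh] := exists_not_hnull cE Ep Eq pq qE.
pose T := [set u | 0 < u /\ hnull u E].
have hT : lbound T h.
  move=> u [u0 nu]; rewrite leNgt; apply/negP => uh; apply: nh.
  exact: hnull_exponent u0 (ltW uh) nu.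
have infT : has_inf T by split; [exists t|exists h].
exists (inf T); split=> [|u u0].
  by apply: (lt_le_trans h0); apply: lb_le_inf => //; exists t.
split=> [nu|]; first by apply: ge_inf => //; exists h.
move=> /inf_lt[|v [v0 nv] vu]; first by exists t.
exact: hnull_exponent v0 (ltW vu) nv.
Qed.

Lemma critical_exponent_congr E F s :
  (forall t, 0 < t -> hnull t E <-> hnull t F) ->
  critical_exponent E s -> critical_exponent F s.
Proof.
by move=> EF [s0 crit]; split=> // t t0; rewrite -!EF//; exact: crit.
Qed.

Lemma ereal_inf_threshold (A : set R) s : (forall t, A t -> s <= t) ->
  (forall t, s < t -> A t) -> ereal_inf [set t%:E | t in A] = s%:E.
Proof.
move=> As sA; apply: le_anti; apply/andP; split.
  apply/lee_addgt0Pr => e e0; rewrite -EFinD; apply: ereal_inf_lbound.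
  by exists (s + e) => //; apply: sA; rewrite ltrDl.
by apply: le_ereal_inf_tmp => _ [t At <-]; rewrite lee_fin As.
Qed.

Lemma hausdorff_dim_critical E s :
  critical_exponent E s -> hausdorff_dim E = s%:E.
Proof.
move=> [s0 crit]; apply: ereal_inf_threshold => t.
  by move=> [t0 /(hnullP E t0)]; exact: (crit _ t0).1.
move=> st; have t0 := lt_trans s0 st.
by split=> //; apply/(hnullP E t0); exact: (crit _ t0).2.
Qed.

End CriticalExponent.

(** * Filling packings with disjoint copies *)

Section Packings.
Context {R : realType} {d : nat}.
Implicit Types (E F : set 'rV[R]_d) (c t r s : R) (f : 'rV[R]_d -> 'rV[R]_d).

Definition packing (J : finType) (x : J -> 'rV[R]_d) (r : J -> R) :=
  (forall j, 0 < r j) /\ forall i j, i != j -> r i + r j <= edist (x i) (x j).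

(** The new copies lie in balls of radius [r j / 3], which leaves room in the strict sense: two of
    these balls are disjoint because the centres are at distance at least [r i + r j], and the old
    copies stay at distance at least [r j] from the centre. *)
Lemma extend_disjoint_copies E a r0 (I J : finType) (c : I -> R)
    (f : I -> 'rV[R]_d -> 'rV[R]_d) (x : J -> 'rV[R]_d) (r : J -> R) :
  (forall y r', E y -> 0 < r' <= r0 -> exists c' f', [/\ similarity c' f',
     a * r' <= c' & forall z, E z -> E (f' z) /\ edist y (f' z) <= r']) ->
  disjoint_copies E c f -> packing x r -> (forall j, E (x j)) ->
  (forall j, r j <= 2 * r0) ->
  (forall i j y, E y -> r j <= edist (x j) (f i y)) ->
  exists (c' : J -> R) (f' : J -> 'rV[R]_d -> 'rV[R]_d),
    disjoint_copies E (fun k : I + J => match k with inl i => c i | inr j => c' j end)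
      (fun k : I + J => match k with inl i => f i | inr j => f' j end) /\
    forall j, a * (r j / 3) <= c' j /\
      forall y, E y -> edist (x j) (f' j y) <= r j / 3.
Proof.
move=> qa [simf fE disj] [r_gt0 sep] Ex rr0 far.
have /choice[g gP] (j : J) : exists g : R * ('rV[R]_d -> 'rV[R]_d),
    [/\ similarity g.1 g.2, a * (r j / 3) <= g.1 &
      forall z, E z -> E (g.2 z) /\ edist (x j) (g.2 z) <= r j / 3].
  have [|c' [f' h]] := qa (x j) (r j / 3) (Ex j); last by exists (c', f').
  by rewrite divr_gt0//=; have := rr0 j; have := r_gt0 j; lra.
exists (fun j => (g j).1), (fun j => (g j).2); split; last first.
  move=> j; have [_ ac gE] := gP j; split=> // y Ey; by case: (gE y Ey).
have out i j y z : E y -> E z -> f i y <> (g j).2 z.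
  move=> Ey Ez fg; have := far i j y Ey; have [_ _ /(_ _ Ez)[_]] := gP j.
  by rewrite fg; have := r_gt0 j; lra.
split=> [[i|j]|[i|j]|[i|j] [k|l]].
- exact: simf.
- by case: (gP j).
- exact: fE.
- by move=> _ [y Ey <-]; have [_ _ /(_ _ Ey)[]] := gP j.
- by move=> ik; apply: disj; apply: contra ik => /eqP ->.
- by move=> _; rewrite -subset0 => _ [[y Ey <-] [z Ez /esym/out]]; apply.
- by move=> _; rewrite -subset0 => _ [[y Ey <-] [z Ez /out]]; apply.
- move=> jl; have {}jl : j != l by apply: contra jl => /eqP ->.
  rewrite -subset0 => _ [[y Ey <-] [z Ez zy]].
  have [_ _ /(_ _ Ey)[_ h1]] := gP j; have [_ _ /(_ _ Ez)[_]] := gP l.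
  rewrite zy => h2; exfalso; have := sep _ _ jl; have := r_gt0 j; have := r_gt0 l.
  have := edist_triangle ((g j).2 y) (x j) (x l).
  by rewrite (edistC ((g j).2 y) (x l)); lra.
Qed.

(** Extending the empty family of copies, each ball receives a copy of ratio at least a r/3 =
    (a/6)(2r). Since the s-th powers of the ratios sum to at most 1, C is the inverse of the s-th
    power of a/6. *)
Lemma packing_sum_bound E s p q : compact E -> E p -> E q -> p != q ->
  critical_exponent E s -> quasi_self_similar E ->
  forall r0, 0 < r0 -> exists2 C, 0 < C &
    forall (J : finType) (x : J -> 'rV[R]_d) (r : J -> R), packing x r ->
      (forall j, E (x j)) -> (forall j, r j <= r0) ->
      \sum_j (2 * r j) `^ s <= C.
Proof.
move=> cE Ep Eq pq crit qE r0 r00; have [a a0 qa] := qE r0 r00.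
have s0 : 0 < s by case: crit.
have b0 : 0 < a / 6 by rewrite divr_gt0.
exists ((a / 6) `^ s)^-1 => [|J x r pack Ex rr0]; first by rewrite invr_gt0 powR_gt0.
have void_copies : disjoint_copies E (fun i : void => match i with end)
    (fun i : void => match i with end) by split; case.
have rr j : r j <= 2 * r0 by have := rr0 j; lra.
have [c' [f' [copies cP]]] := extend_disjoint_copies qa void_copies pack Ex rr
  (fun i => match i with end).
have := sum_copies_le1 cE Ep Eq pq crit copies.
rewrite big_sumType/= big_pred0// add0r => sum1.
rewrite -[_^-1]mul1r ler_pdivlMr ?powR_gt0//; apply: le_trans sum1.
rewrite mulr_suml; apply: ler_sum => j _.
have rj : 0 <= r j by apply: ltW; case: pack.
have rj2 : 0 <= 2 * r j by rewrite mulr_ge0.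
rewrite -(powRM s rj2 (ltW b0)); apply: (ge0_ler_powR (ltW s0)).
- by rewrite nnegrE mulr_ge0// ltW.
- by rewrite nnegrE; case: copies => /(_ (inr j))[/ltW].
- by apply: le_trans (cP j).1; rewrite le_eqVlt; apply/orP; left; apply/eqP; field.
Qed.

End Packings.

(** * Packing dimension *)

(** For families of covers: a finite sum over pairs is grouped by the first index, and each group is
    completed to a series. *)
Lemma sum_uniq_pair_le {R : realType} (K : eqType) (a : K * nat -> \bar R)
    (s : seq (K * nat)) : (forall p, 0 <= a p)%E -> uniq s ->
  (\sum_(p <- s) a p <=
   \sum_(k <- undup (map fst s)) \sum_(j <oo) a (k, j))%E.
Proof.
move=> a0 us.
have -> : (\sum_(p <- s) a p = \sum_(p <- s)
    \sum_(k <- undup (map fst s) | k == p.1) a p)%E.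
  rewrite big_seq_cond [RHS]big_seq_cond; apply: eq_bigr => p /andP[ps _].
  by rewrite -big_filter filter_pred1_uniq ?undup_uniq ?big_seq1 ?mem_undup ?map_f.
rewrite (exchange_big_dep xpredT)//=; apply: lee_sum => k _.
rewrite (eq_bigl (fun p => p.1 == k)); last by move=> p; rewrite eq_sym.
have -> : (\sum_(p <- s | p.1 == k) a p =
    \sum_(j <- [seq p.2 | p <- s & p.1 == k]) a (k, j))%E.
  by rewrite big_map big_filter; apply: eq_bigr => -[? ?] /= /eqP ->.
apply: sum_uniq_le_nneseries => //.
rewrite map_inj_in_uniq ?filter_uniq// => -[k1 j1] [k2 j2].
by rewrite !mem_filter /= => /andP[/eqP -> _] /andP[/eqP -> _] ->.
Qed.

Section PackingDimension.
Context {R : realType} {d : nat}.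
Implicit Types (E F U : set 'rV[R]_d) (t r s delta : R).

Lemma packing_premeasure_at_ge0 t delta U :
  (0 <= packing_premeasure_at t delta U)%E.
Proof.
apply: ereal_sup_ubound; exists 0%N, (fun=> 0), (fun=> 1); split.
- by case.
- by case.
- by case.
- by rewrite big_ord0.
Qed.

Lemma packing_premeasure_ge0 t U : (0 <= packing_premeasure t U)%E.
Proof.
by apply: le_ereal_inf_tmp => _ [delta _ <-]; exact: packing_premeasure_at_ge0.
Qed.

(* Doubling the radii of a maximal packing by balls of radius [delta] gives a
   cover. *)
Lemma cover_le_packing t delta U : 0 < t -> 0 < delta ->
  (packing_premeasure_at t delta U < +oo)%E ->
  exists2 Y : nat -> set 'rV[R]_d, U `<=` \bigcup_j Y j &
    (\sum_(j <oo) diam (Y j) `^ t <=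
      (2 `^ t)%:E * packing_premeasure_at t delta U)%E.
Proof.
move=> t0 delta0 fin.
have P0 := packing_premeasure_at_ge0 t delta U.
have Pfin : packing_premeasure_at t delta U \is a fin_num by rewrite ge0_fin_numE.
set B := fine (packing_premeasure_at t delta U).
have PB : packing_premeasure_at t delta U = B%:E by rewrite /B fineK.
have q0 : 0 < (2 * delta) `^ t by rewrite powR_gt0// mulr_gt0.
(* The strict inequality makes the closed balls of radius [delta] disjoint. Finiteness of the
   premeasure bounds [N], so a maximal separated family exists. *)
pose sep N := exists x : 'I_N -> 'rV[R]_d, (forall i, U (x i)) /\
  forall i j, i != j -> 2 * delta < edist (x i) (x j).
have sepB N : sep N -> N%:R * (2 * delta) `^ t <= B.
  move=> [x [Ux xsep]]; rewrite -lee_fin -PB; apply: ereal_sup_ubound.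
  exists N, x, (fun=> delta); split=> //.
  - by move=> _; rewrite delta0 lexx.
  - move=> i j _ _ [y []]; rewrite /ecball/= => iy jy; apply/eqP; apply/negPn/negP => /xsep.
    by have := edist_triangle y (x i) (x j); rewrite (edistC y); lra.
  - by rewrite sumr_const card_ord [in LHS]mulr_natl.
have ex : exists N, `[< sep N >].
  by exists 0%N; apply/asboolP; exists (fun=> 0); split=> -[].
have ub N : `[< sep N >] -> (N <= Num.truncn (B / (2 * delta) `^ t))%N.
  move=> /asboolP/sepB; rewrite -ler_pdivlMr// => NB.
  by rewrite truncn_ge_nat// (le_trans _ NB).
case: (ex_maxnP ex ub) => N /asboolP sepN maxN.
have [x [Ux xsep]] := sepN.
have cover y : U y -> exists i, edist (x i) y <= 2 * delta.
  move=> Uy; apply: contrapT => far.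
  have {}far i : 2 * delta < edist (x i) y.
    by rewrite ltNge; apply/negP => le; apply: far; exists i.
  have : `[< sep N.+1 >].
    apply/asboolP; exists (fun i => if unlift ord0 i is Some j then x j else y).
    split=> [i|i j]; first by case: unliftP.
    case: unliftP => [i'|] ->; case: unliftP => [j'|] -> //.
    + by move=> ij; apply: xsep; apply: contra ij => /eqP ->.
    + by rewrite edistC.
  by move/maxN; rewrite ltnn.
exists (fun j => oapp (fun i => ecball (x i) (2 * delta)) set0
  (pickle_inv j : option 'I_N)).
  move=> y /cover[i iy]; exists (pickle i) => //=; rewrite pickleK_inv//=.
have h (s : seq 'I_N) : uniq s ->
    (\sum_(i <- s) diam (ecball (x i) (2 * delta)) `^ t <=
     (2 `^ t)%:E * packing_premeasure_at t delta U)%E.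
  move=> us; apply: (@le_trans _ _ (\sum_(i <- s) (2 `^ t * (2 * delta) `^ t)%:E)%E).
    apply: lee_sum => i _; rewrite EFinM.
    rewrite -(poweR_EFin (2 * delta)); apply: diam_poweR_le => [||| u v ].
    - exact: ltW.
    - by [].
    - by rewrite lee_fin mulr_ge0// ltW.
    - rewrite /ecball /= => xu xv; rewrite -EFinM lee_fin.
      by have := edist_triangle (x i) u v; rewrite (edistC u (x i)); lra.
  rewrite sumEFin PB -EFinM lee_fin -mulr_sumr ler_wpM2l ?powR_ge0//.
  apply: le_trans (sepB _ sepN).
  rewrite big_const_seq iter_addr_0 -[leLHS]mulr_natl ler_wpM2r ?powR_ge0//.
  by rewrite ler_nat count_predT -[N in (_ <= N)%N]card_ord -(card_uniqP us) max_card.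
have := nneseries_count (fun i => poweR_ge0 _ t) h.
congr (_ <= _)%E; congr (limn _); apply/funext => n; apply: eq_bigr => j _.
by case: pickle_inv => //=; rewrite poweR_diam0.
Qed.

Lemma hnull_of_packing_null t F : 0 < t -> packing_measure t F = 0%E -> hnull t F.
Proof.
move=> t0 F0; apply: (hnull_count t0) => e e0.
set e' := e / (2 `^ t) / 2.
have q0 : (0 : R) < 2 `^ t by rewrite powR_gt0.
have e'0 : 0 < e' by rewrite !divr_gt0.
have : (packing_measure t F < e'%:E)%E by rewrite F0 lte_fin.
move=> /ereal_inf_lt[_ [U FU <-]] /ltW Ue.
have Pj j : (packing_premeasure t (U j) <= e'%:E)%E.
  apply: le_trans Ue.
  have /= := @sum_uniq_le_nneseries R (fun j => packing_premeasure t (U j)) [:: j].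
  by rewrite big_seq1; apply => // i; exact: packing_premeasure_ge0.
have /choice[Y YP] j : exists Y : nat -> set 'rV[R]_d, U j `<=` \bigcup_i Y i /\
    (\sum_(i <oo) diam (Y i) `^ t <= (2 `^ t)%:E *
      (packing_premeasure t (U j) + (e' * 2^-1 ^+ j.+1)%:E))%E.
  have Pfin : packing_premeasure t (U j) \is a fin_num.
    by rewrite ge0_fin_numE ?packing_premeasure_ge0// (le_lt_trans (Pj j)) ?ltry.
  have : (packing_premeasure t (U j) <
      packing_premeasure t (U j) + (e' * 2^-1 ^+ j.+1)%:E)%E.
    by rewrite lteDl// lte_fin mulr_gt0// exprn_gt0.
  move=> /ereal_inf_lt[_ [delta /= delta0 <-] lt].
  have [|Y UY Ye] := cover_le_packing (U := U j) t0 delta0.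
    by apply: lt_trans lt _; rewrite -(fineK Pfin) -EFinD ltry.
  exists Y; split=> //; apply: le_trans Ye _.
  by apply: lee_wpmul2l; [rewrite lee_fin ltW|exact: ltW].
exists (nat * nat)%type, (fun p => Y p.1 p.2); split.
  move=> x /FU[j _ Ujx]; have [/(_ _ Ujx)[i _ Yx] _] := YP j.
  by exists (j, i).
move=> s us; apply: le_trans (sum_uniq_pair_le _ us) _.
  by move=> p; exact: poweR_ge0.
apply: (@le_trans _ _ (\sum_(j <- undup (map fst s)) (2 `^ t)%:E *
      (packing_premeasure t (U j) + (e' * 2^-1 ^+ j.+1)%:E))%E).
  by apply: lee_sum => j _; case: (YP j).
apply: (@le_trans _ _ (\sum_(j <oo) (2 `^ t)%:E *
      (packing_premeasure t (U j) + (e' * 2^-1 ^+ j.+1)%:E))%E).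
  apply: sum_uniq_le_nneseries; last exact: undup_uniq.
  move=> j; rewrite mule_ge0 ?lee_fin ?powR_ge0// adde_ge0 ?packing_premeasure_ge0//.
  by rewrite lee_fin mulr_ge0 ?exprn_ge0// ltW.
have half_ge0 j : (0 <= (e' * 2^-1 ^+ j.+1)%:E)%E.
  by rewrite lee_fin mulr_ge0 ?exprn_ge0// ltW.
rewrite nneseriesZl; last first.
  by move=> j _; rewrite adde_ge0 ?packing_premeasure_ge0.
rewrite nneseriesD; [|by move=> *; exact: packing_premeasure_ge0|by move=> *].
have -> : e%:E = ((2 `^ t)%:E * (e'%:E + e'%:E))%E.
  by rewrite -EFinD -EFinM; congr EFin; rewrite /e'; field; rewrite gt_eqF.
apply: lee_wpmul2l; first by rewrite lee_fin ltW.
apply: leeD => //; apply: nneseries_le => // n.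
rewrite sumEFin lee_fin -mulr_sumr -[leRHS]mulr1 big_mkord.
by apply: (ler_wpM2l (ltW e'0)); exact: geometric_sum_le1.
Qed.

(** For t > s and diameters at most h, a t-sum is at most h^(t-s) times an s-sum, and the s-sums are
    bounded by a multiple of C; so the t-premeasure of [E] vanishes. *)
Lemma packing_dim_critical E s C : critical_exponent E s -> 0 < C ->
  (forall (J : finType) (x : J -> 'rV[R]_d) (r : J -> R), packing x r ->
    (forall j, E (x j)) -> (forall j, r j <= 1) ->
    \sum_j (2 * r j) `^ s <= C) ->
  packing_dim E = s%:E.
Proof.
move=> [s0 crit] C0 bound; apply: ereal_inf_threshold => t.
  by move=> [t0 /(hnull_of_packing_null t0)]; exact: (crit _ t0).1.
move=> st; have t0 := lt_trans s0 st; split=> //.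
have premeasure0 U : U = E \/ U = set0 -> packing_premeasure t U = 0%E.
  move=> UE; apply: le_anti; rewrite packing_premeasure_ge0 andbT.
  apply/lee_addgt0Pr => e e0; rewrite add0e.
  have q0 : (0 : R) < 2 `^ s by rewrite powR_gt0.
  have [h h0 he] : exists2 h, 0 < h & h `^ (t - s) <= e / (2 `^ s * C).
    by apply: powR_arbitrarily_small; rewrite ?subr_gt0// divr_gt0// mulr_gt0.
  apply: (@le_trans _ _ (packing_premeasure_at t (Num.min (h / 2) 1) U)).
    by apply: ereal_inf_lbound; exists (Num.min (h / 2) 1) => //=;
      rewrite lt_min divr_gt0/=.
  apply: ge_ereal_sup => _ [N [x [r [Ux rb disj ->]]]]; rewrite lee_fin.
  case: UE => UE; last first.
    by rewrite big1 ?ltW// => i _; have := Ux i; rewrite UE.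
  have r0 i : 0 < r i by case/andP: (rb i).
  have pack : packing x (fun i => r i / 2).
    split=> [i|i j ij]; first by rewrite divr_gt0.
    have far k l : k != l -> r k < edist (x k) (x l).
      move=> kl; rewrite ltNge; apply/negP => le; move/eqP: kl; apply.
      apply: disj => //; exists (x l); split=> //=.
      by rewrite /ecball/= edistxx ltW.
    by have := far i j ij; have := far j i; rewrite eq_sym edistC => /(_ ij); lra.
  have := bound _ x (fun i => r i / 2) pack; rewrite -UE => /(_ Ux) sum_le.
  apply: (@le_trans _ _ (\sum_i (2 `^ s * h `^ (t - s)) * (2 * (r i / 2)) `^ s)).
    apply: ler_sum => i _.
    have -> : 2 * (r i / 2) = r i by field.
    have r2 : 0 < 2 * r i by rewrite mulr_gt0.
    have -> : (2 * r i) `^ t = (2 * r i) `^ (t - s) * (2 `^ s * r i `^ s).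
      rewrite -(powRM s (ler0n _ _) (ltW (r0 i))) -powRD ?subrK//.
      by rewrite (gt_eqF r2) implybT.
    rewrite [leRHS](_ : _ = h `^ (t - s) * (2 `^ s * r i `^ s)); last by ring.
    apply: ler_wpM2r; first by rewrite mulr_ge0 ?powR_ge0.
    have ts : 0 <= t - s by rewrite subr_ge0 ltW.
    apply: (ge0_ler_powR ts); rewrite ?nnegrE ?(ltW r2) ?(ltW h0)//.
    by case/andP: (rb i) => _; rewrite le_min => /andP[rh _]; lra.
  rewrite -mulr_sumr; apply: (@le_trans _ _ (2 `^ s * h `^ (t - s) * C)).
    apply: ler_wpM2l; first by rewrite mulr_ge0 ?powR_ge0.
    apply: sum_le => i; case/andP: (rb i) => ri; rewrite le_min => /andP[_ r1].
    by have := r0 i; lra.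
  by rewrite mulrAC mulrC -ler_pdivlMr// mulr_gt0.
apply: le_anti; apply/andP; split; last first.
  apply: le_ereal_inf_tmp => _ [U _ <-].
  by apply: nneseries_ge0 => *; exact: packing_premeasure_ge0.
apply: (@le_trans _ _ (\sum_(j <oo) packing_premeasure t
    (if j == 0%N then E else set0))%E).
  by apply: ereal_inf_lbound; exists (fun j => if j == 0%N then E else set0) => //;
    move=> x Ex; exists 0%N.
by rewrite eseries0// => j _ _; apply: premeasure0; case: ifP; [left|right].
Qed.

End PackingDimension.

(** * Labelled packing quantities *)

Section LabelledPackings.
Context {R : realType} {d : nat}.
Implicit Types (A B E F K : set 'rV[R]_d) (c s rho delta : R).

(** One ball of the largest admissible radius is a packing. Thus the cost of a nonempty set controls
    its label. *)
Lemma powR_radius_le_Phi s A rho : A !=set0 -> 0 < rho ->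
  (((2 * rho) `^ s)%:E <= Phi s A rho)%E.
Proof.
move=> [x Ax] rho0; rewrite /Phi; case: eqP => [A0|_]; first by rewrite A0 in Ax.
apply: ereal_sup_ubound; exists 1%N, (fun=> x), (fun=> rho); split=> //.
- by move=> _; exact: subset_closure.
- by move=> _; rewrite rho0 lexx.
- by move=> i j; rewrite [i]ord1 [j]ord1 eqxx.
- by rewrite big_ord1.
Qed.

Lemma Phi_set0 s rho : Phi s (set0 : set 'rV[R]_d) rho = 0%E.
Proof. by rewrite /Phi eqxx. Qed.

Lemma Phi_ge0 s A rho : 0 < rho -> (0 <= Phi s A rho)%E.
Proof.
move=> rho0; have [->|/set0P A0] := eqVneq A set0; first by rewrite Phi_set0.
by apply: le_trans (powR_radius_le_Phi s A0 rho0); rewrite lee_fin powR_ge0.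
Qed.

Lemma Phi_le s A rho (b : \bar R) : (0 <= b)%E ->
  (forall (J : finType) (x : J -> 'rV[R]_d) (r : J -> R), packing x r ->
    (forall j, closure A (x j)) -> (forall j, r j <= rho) ->
    ((\sum_j (2 * r j) `^ s)%:E <= b)%E) ->
  (Phi s A rho <= b)%E.
Proof.
move=> b0 h; rewrite /Phi; case: eqP => // _.
apply: ge_ereal_sup => _ [N [x [r [_ Ax rb sep ->]]]]; apply: h => //.
  by split=> // j; case/andP: (rb j).
by move=> j; case/andP: (rb j).
Qed.

Lemma Phi_subset s A B rho : 0 < rho -> A `<=` B -> (Phi s A rho <= Phi s B rho)%E.
Proof.
move=> rho0 AB; have [->|/set0P[x Ax]] := eqVneq A set0.
  by rewrite Phi_set0 Phi_ge0.
rewrite /Phi; case: eqP => [A0|_]; first by rewrite A0 in Ax.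
case: eqP => [B0|_]; first by move: (AB _ Ax); rewrite B0.
apply: le_ereal_sup => _ [N [y [r [N1 Ay rb sep ->]]]].
by exists N, y, r; split=> // i; exact: closureS (Ay i).
Qed.

Lemma closure_image_subset E A c (f : 'rV[R]_d -> 'rV[R]_d) :
  compact E -> A `<=` E -> similarity c f -> closure (f @` A) `<=` f @` closure A.
Proof.
move=> cE AE simf; have cA : compact (closure A).
  apply: (subclosed_compact _ cE); first exact: closed_closure.
  exact: subset_trans (closureS AE) (compact_closed_rV cE).
apply: subset_trans (compact_closed_rV (similarity_compact simf cA)).
by apply: closureS => _ [x Ax <-]; exists x => //; exact: subset_closure.
Qed.

(** Packings of the image are pulled back with radii divided by [c]. Centres in the closure of the
    image have preimages because the closure of [A] is compact. *)
Lemma Phi_similarity s E A c (f : 'rV[R]_d -> 'rV[R]_d) rho :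
  0 < rho -> compact E -> A `<=` E -> similarity c f ->
  (Phi s (f @` A) (c * rho) <= (c `^ s)%:E * Phi s A rho)%E.
Proof.
move=> rho0 cE AE simf; have [c0 fc] := simf.
have cs0 : 0 < c `^ s by rewrite powR_gt0.
have [->|/set0P[x0 Ax0]] := eqVneq A set0.
  by rewrite image_set0 !Phi_set0 mule0.
have AN0 : A <> set0 by move=> A0; rewrite A0 in Ax0.
rewrite {1}/Phi; case: eqP => [_|_]; first by apply: mule_ge0; [rewrite lee_fin ltW|exact: Phi_ge0].
apply: ge_ereal_sup => _ [N [y [r [N1 Ay rb sep ->]]]].
have /choice[x xP] i : exists x, closure A x /\ f x = y i.
  by have [x Ax <-] := closure_image_subset cE AE simf (Ay i); exists x.
have r0 i : 0 < r i by case/andP: (rb i).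
have -> : \sum_(i < N) (2 * r i) `^ s =
    c `^ s * \sum_(i < N) (2 * (r i / c)) `^ s.
  rewrite mulr_sumr; apply: eq_bigr => i _.
  have rc0 : 0 <= 2 * (r i / c) by rewrite mulr_ge0// divr_ge0 ?ltW.
  rewrite -(powRM s (ltW c0) rc0).
  by congr (_ `^ s); field; rewrite gt_eqF.
rewrite EFinM lee_pmul2l ?lte_fin// /Phi; case: eqP => [//|_].
apply: ereal_sup_ubound; exists N, x, (fun i => r i / c); split=> //.
- by move=> i; case: (xP i).
- move=> i; rewrite divr_gt0//= ler_pdivrMr// mulrC.
  by case/andP: (rb i).
- move=> i j ij; rewrite -mulrDl ler_pdivrMr// mulrC -fc.
  by case: (xP i) => _ ->; case: (xP j) => _ ->; exact: sep.
Qed.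

(* Packings of mutually distant sets merge into a single one. *)
Lemma sum_Phi_separated (I : eqType) (K : I -> set 'rV[R]_d) (rho : I -> R) s
    (l : seq I) b : uniq l -> (forall i, 0 < rho i) ->
  (forall i j x y, i \in l -> j \in l -> i != j -> closure (K i) x ->
    closure (K j) y -> rho i + rho j <= edist x y) ->
  (forall (J : finType) (x : J -> 'rV[R]_d) (r : J -> R), packing x r ->
    (forall j, exists2 i, i \in l & closure (K i) (x j) /\ r j <= rho i) ->
    \sum_j (2 * r j) `^ s <= b) ->
  (\sum_(i <- l) Phi s (K i) (rho i) <= b%:E)%E.
Proof.
move=> + rho0; elim: l b => [|i l ih] b /= => [_ _ h|/andP[il ul] sep h].
  rewrite big_nil lee_fin; have := h void (fun i => match i with end)
    (fun i => match i with end).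
  by rewrite big_pred0//; apply=> [|[]]; split=> -[].
have sepl j k x y : j \in l -> k \in l -> j != k -> closure (K j) x ->
    closure (K k) y -> rho j + rho k <= edist x y.
  by move=> jl kl; apply: sep; rewrite inE ?jl ?kl orbT.
(* A fixed packing of [K i] uses up its share of [b], and the induction hypothesis bounds the other
   sets by what is left. The supremum over these packings is taken at the end. *)
have partial (J : finType) (x : J -> 'rV[R]_d) (r : J -> R) : packing x r ->
    (forall j, closure (K i) (x j)) -> (forall j, r j <= rho i) ->
    (\sum_(k <- l) Phi s (K k) (rho k) <= (b - \sum_j (2 * r j) `^ s)%:E)%E.
  move=> [r0 xsep] Kx rr; apply: ih => // J' x' r' [r0' xsep'] Kx'.
  have far j j' : r j + r' j' <= edist (x j) (x' j').
    have [k kl [Kk rk]] := Kx' j'; apply: le_trans (lerD (rr j) rk) _.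
    apply: sep (Kx j) Kk; rewrite ?inE ?eqxx ?kl ?orbT//.
    by apply: contra il => /eqP ->.
  have := h (J + J')%type (fun k => match k with inl j => x j | inr j => x' j end)
    (fun k => match k with inl j => r j | inr j => r' j end).
  rewrite big_sumType/= lerBrDl; apply.
    split=> [[]//|[j|j] [k|k] jk]; [|exact: far| |].
    - by apply: xsep; apply: contra jk => /eqP ->.
    - by rewrite addrC edistC far.
    - by apply: xsep'; apply: contra jk => /eqP ->.
  move=> [j|j]; first by exists i; rewrite ?inE ?eqxx.
  by have [k kl ?] := Kx' j; exists k; rewrite // inE kl orbT.
(* The empty packing shows that the tail is finite, so it may be subtracted. *)
have sum_b : (\sum_(k <- l) Phi s (K k) (rho k) <= b%:E)%E.
  have := partial void (fun i => match i with end) (fun i => match i with end).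
  by rewrite [X in b - X]big_pred0// subr0; apply=> [|[]|[]]; split=> -[].
have sum_ge0 : (0 <= \sum_(k <- l) Phi s (K k) (rho k))%E.
  by apply: sume_ge0 => k _; exact: Phi_ge0.
have sum_fin : (\sum_(k <- l) Phi s (K k) (rho k))%E \is a fin_num.
  by rewrite ge0_fin_numE// (le_lt_trans sum_b)// ltry.
rewrite big_cons -leeBrDr//; move: sum_b sum_ge0 partial.
rewrite -(fineK sum_fin); set v := fine _; rewrite !lee_fin => vb v0 partial.
rewrite -EFinB; apply: Phi_le; first by rewrite lee_fin subr_ge0.
move=> J x r px Kx rx; have := partial J x r px Kx rx.
by rewrite !lee_fin; lra.
Qed.

Lemma M_delta_ge0 s delta A : (0 <= M_delta s delta A)%E.
Proof.
apply: le_ereal_inf_tmp => _ [E [rho [_ _ rb ->]]].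
by apply: nneseries_ge0 => j _ _; apply: Phi_ge0; case/andP: (rb j).
Qed.

Lemma M_delta_le_count s delta F (b : \bar R) (I : countType)
    (K : I -> set 'rV[R]_d) (rho : I -> R) : 0 < delta ->
  F `<=` \bigcup_i K i -> (forall i, (diam (K i) <= (rho i)%:E)%E) ->
  (forall i, 0 < rho i <= delta) ->
  (forall l : seq I, uniq l -> (\sum_(i <- l) Phi s (K i) (rho i) <= b)%E) ->
  (M_delta s delta F <= b)%E.
Proof.
move=> delta0 FK dK rb sum_le.
apply: (@le_trans _ _ (\sum_(j <oo)
    Phi s (oapp K set0 (pickle_inv j)) (oapp rho delta (pickle_inv j)))%E).
  apply: ereal_inf_lbound; exists (fun j => oapp K set0 (pickle_inv j)),
    (fun j => oapp rho delta (pickle_inv j)); split=> //.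
  - by move=> x /FK[i _ Kx]; exists (pickle i) => //=; rewrite pickleK_inv.
  - by move=> j; case: pickle_inv => //=; rewrite diam0 lee_fin ltW.
  - by move=> j; case: pickle_inv => //=; rewrite delta0 lexx.
have Phi0 i : (0 <= Phi s (K i) (rho i))%E.
  by apply: Phi_ge0; case/andP: (rb i).
have := nneseries_count Phi0 sum_le.
congr (_ <= _)%E; congr (limn _); apply/funext => n; apply: eq_bigr => j _.
by case: pickle_inv => //=; rewrite Phi_set0.
Qed.

Lemma M_delta_setU s delta A B : 0 < delta ->
  (M_delta s delta (A `|` B) <= M_delta s delta A + M_delta s delta B)%E.
Proof.
move=> delta0; have A0 := M_delta_ge0 s delta A; have B0 := M_delta_ge0 s delta B.
have [->|Ay] := eqVneq (M_delta s delta A) +oo%E.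
  by rewrite addye ?leey// gt_eqF// (lt_le_trans _ B0)// ltNye.
have [->|By] := eqVneq (M_delta s delta B) +oo%E.
  by rewrite addey ?leey// gt_eqF// (lt_le_trans _ A0)// ltNye.
have Afin : M_delta s delta A \is a fin_num by rewrite ge0_fin_numE// ltey.
have Bfin : M_delta s delta B \is a fin_num by rewrite ge0_fin_numE// ltey.
apply/lee_addgt0Pr => e e0; have e2 : 0 < e / 2 by rewrite divr_gt0.
have [_ [A' [rA [AA' dA rbA ->]]] /ltW ltA] := lb_ereal_inf_adherent e2 Afin.
have [_ [B' [rB [BB' dB rbB ->]]] /ltW ltB] := lb_ereal_inf_adherent e2 Bfin.
pose K (p : bool * nat) := if p.1 then A' p.2 else B' p.2.
pose rho (p : bool * nat) := if p.1 then rA p.2 else rB p.2.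
have rb p : 0 < rho p <= delta by rewrite /rho; case: ifP.
apply: (M_delta_le_count (K := K) (rho := rho)) => //.
- move=> x [/AA'[j _ ?]|/BB'[j _ ?]]; first by exists (true, j).
  by exists (false, j).
- by move=> [[] j]; [exact: dA|exact: dB].
move=> l ul; have Phi0 p : (0 <= Phi s (K p) (rho p))%E.
  by apply: Phi_ge0; case/andP: (rb p).
apply: le_trans (sum_uniq_pair_le Phi0 ul) _.
apply: (@le_trans _ _ (\sum_(k : bool) \sum_(j <oo) Phi s (K (k, j)) (rho (k, j)))%E).
  rewrite big_uniq ?undup_uniq//= [leRHS](bigID (mem (undup (map fst l))))/=.
  rewrite leeDl// sume_ge0// => k _; apply: nneseries_ge0 => j _ _.
  exact: Phi0.
rewrite big_bool/=; apply: le_trans (leeD ltA ltB) _.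
by rewrite addeACA -EFinD -splitr.
Qed.

Lemma M_delta_bigcup s delta (I : finType) (A : I -> set 'rV[R]_d) : 0 < delta ->
  (M_delta s delta (\bigcup_i A i) <= \sum_i M_delta s delta (A i))%E.
Proof.
move=> delta0; have -> : \bigcup_i A i = \big[setU/set0]_(i <- index_enum I) A i.
  rewrite -bigcup_seq; apply/seteqP; split=> [x [i _ Ax]|x [i _ Ax]]; exists i => //=.
  exact: mem_index_enum.
elim: (index_enum I) => [|i l ih]; last first.
  rewrite !big_cons; apply: le_trans (M_delta_setU s _ _ delta0) _.
  exact: leeD.
rewrite !big_nil.
apply: (M_delta_le_count (K := fun i : void => match i with end)
  (rho := fun i : void => match i with end)) => // -[]//.
by move=> _; rewrite big_nil.
Qed.

Lemma M_delta_image s delta E c (f : 'rV[R]_d -> 'rV[R]_d)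
    (A : nat -> set 'rV[R]_d) (rho : nat -> R) rmax :
  0 < s -> compact E -> similarity c f ->
  E `<=` \bigcup_j A j -> (forall j, (diam (A j) <= (rho j)%:E)%E) ->
  (forall j, 0 < rho j) -> (forall j, A j !=set0 -> rho j <= rmax) ->
  0 < rmax -> c * rmax <= delta ->
  (M_delta s delta (f @` E) <=
    (c `^ s)%:E * \sum_(j <oo) Phi s (A j) (rho j))%E.
Proof.
move=> s0 cE simf EA dA rho0 rho_le rmax0 c_le; have [c0 fc] := simf.
(* Empty sets may carry arbitrarily large labels; as they cost nothing, their label is reset to
   [rmax]. *)
pose r j := if A j == set0 then rmax else rho j.
have r0 j : 0 < r j by rewrite /r; case: ifP.
have r_le j : r j <= rmax by rewrite /r; case: eqP => // /eqP/set0P/rho_le.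
have dr j : (diam (A j) <= (r j)%:E)%E.
  by rewrite /r; case: eqP => // ->; rewrite diam0 lee_fin ltW.
rewrite -nneseriesZl; last by move=> j _; exact: Phi_ge0.
apply: (@le_trans _ _ (\sum_(j <oo) Phi s (f @` (A j `&` E)) (c * r j))%E).
  apply: ereal_inf_lbound; exists (fun j => f @` (A j `&` E)), (fun j => c * r j).
  split=> //.
  - by move=> _ [x Ex <-]; have [j _ Ax] := EA _ Ex; exists j => //; exists x.
  - move=> j; apply/diam_leP; first by rewrite lee_fin mulr_ge0 ?ltW.
    move=> _ _ [x [Ax _] <-] [y [Ay _] <-]; rewrite fc lee_fin ler_pM2l//.
    by rewrite -lee_fin; apply: le_trans (dr j); exact: edist_le_diam.
  - move=> j; rewrite mulr_gt0//=; apply: le_trans c_le.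
    by rewrite ler_pM2l.
apply: lee_nneseries => [j _ _|j _].
  by apply: Phi_ge0; rewrite mulr_gt0.
apply: le_trans (Phi_similarity s (r0 j) cE (@subIsetr _ _ _) simf) _.
apply: lee_wpmul2l; first by rewrite lee_fin powR_ge0.
apply: le_trans (Phi_subset s (r0 j) (@subIsetl _ _ _)) _.
by rewrite /r; case: eqP => // ->; rewrite !Phi_set0.
Qed.

Lemma M_infty_le_M_delta s delta A : (M_infty s A <= M_delta s delta A)%E.
Proof.
apply: ereal_inf_le_tmp => _ [E [rho [AE dE rb ->]]].
by exists E, rho; split=> // j; case/andP: (rb j).
Qed.

End LabelledPackings.

(** * Coloured grids *)

Section Grid.
Context {R : realType} {d : nat}.
Implicit Types (x y : 'rV[R]_d) (e : R) (z : {ffun 'I_d -> int}).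

Definition cell e z : set 'rV[R]_d :=
  [set x | forall k, (z k)%:~R * e <= x 0 k < ((z k)%:~R + 1) * e].

(** Distinct cells of one colour differ by at least 2d + 3 in some coordinate, so their closures are
    at distance at least (2d + 2)e. This is twice the label (d + 1)e, which exceeds the diameter of
    a cell; the number of colours does not depend on e. *)
Definition cell_colour z : {ffun 'I_d -> 'I_(2 * d).+3} :=
  [ffun k => inord `|(z k %% (2 * d).+3%:Z)%Z|%N].

Lemma cell_cover e x : 0 < e -> exists z, cell e z x.
Proof.
move=> e0; exists [ffun k => Num.floor (x 0 k / e)] => k; rewrite ffunE.
rewrite -ler_pdivlMr// -ltr_pdivrMr//; have := floor_itv (x 0 k / e).
by rewrite intrD.
Qed.

Lemma cell_edist e z x y : 0 < e -> cell e z x -> cell e z y ->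
  edist x y <= d%:R * e.
Proof.
move=> e0 zx zy; apply: edist_le_coord => [|k]; first exact: ltW.
have /andP[a1 a2] := zx k; have /andP[b1 b2] := zy k.
by rewrite ler_norml; apply/andP; split; lra.
Qed.

Lemma closure_cell e z x k : closure (cell e z) x ->
  (z k)%:~R * e <= x 0 k <= ((z k)%:~R + 1) * e.
Proof.
move=> zx; apply/andP; split; apply/ler_addgt0Pr => h h0;
  have [y /(_ k)/andP[y1 y2] xy] := closure_edist h0 zx;
  have := le_lt_trans (coord_le_edist x y k) xy;
  by rewrite ltr_distlC => /andP[? ?]; lra.
Qed.

Lemma cell_far e z z' x y : 0 < e -> cell_colour z = cell_colour z' -> z != z' ->
  closure (cell e z) x -> closure (cell e z') y ->
  2 * (d.+1%:R * e) <= edist x y.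
Proof.
move=> e0 zz' neq zx zy.
have [k neqk] : exists k, z k != z' k.
  apply/existsP; rewrite -negb_forall; apply: contra neq => /forallP h.
  by apply/eqP/ffunP => k; exact/eqP.
have m0 : (2 * d).+3%:Z != 0 by [].
have mod_lt a : (`|(a %% (2 * d).+3%:Z)%Z| < (2 * d).+3)%N.
  by rewrite -ltz_nat gez0_abs ?modz_ge0// ltz_pmod.
have dvd : ((2 * d).+3%:Z %| z k - z' k)%Z.
  rewrite -eqz_mod_dvd; apply/eqP.
  have /ffunP/(_ k) := zz'; rewrite !ffunE => /(congr1 val)/=.
  rewrite !inordK// => h.
  by rewrite -[LHS]gez0_abs ?modz_ge0// -[RHS]gez0_abs ?modz_ge0// h.
have far : ((2 * d).+3 <= `|z k - z' k|)%N.
  by rewrite dvdn_leq// absz_gt0 subr_eq0.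
have far' : (2 * d%:R + 3 : R) <= `|(z k)%:~R - (z' k)%:~R|.
  rewrite -intrB -intr_norm -natr_absz; move: far; rewrite -(ler_nat R).
  by apply: le_trans; rewrite -(addn3 (2 * d)) (natrD _ (2 * d)) (natrM _ 2).
have /andP[x1 x2] := closure_cell k zx; have /andP[y1 y2] := closure_cell k zy.
apply: le_trans (coord_le_edist x y k).
move: far'; set a := (z k)%:~R; set b := (z' k)%:~R => far'.
have {}far' : (2 * d%:R + 3) * e <= `|a * e - b * e|.
  by rewrite -mulrBl normrM (gtr0_norm e0) ler_pM2r.
rewrite -natr1; have [ab|ab] := leP (b * e) (a * e).
  move: far'; rewrite ger0_norm ?subr_ge0// => far'.
  by apply: le_trans (ler_norm _); lra.
move: far'; rewrite ltr0_norm ?subr_lt0// => far'.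
by rewrite distrC; apply: le_trans (ler_norm _); lra.
Qed.

End Grid.

(** * Exhaustion by copies *)

Section Layers.
Context {R : realType} {d : nat}.
Implicit Types (x y : 'rV[R]_d) (E G : set 'rV[R]_d).

Lemma geometric_small (e : R) : 0 < e -> exists n, (2^-1 : R) ^+ n <= e.
Proof.
move=> e0; exists (Num.truncn e^-1).+1.
rewrite exprVn -[leRHS]invrK lef_pV2 ?posrE ?exprn_gt0 ?invr_gt0//.
apply: (@le_trans _ _ (Num.truncn e^-1).+1%:R).
  by apply/ltW; rewrite truncnS_gt.
by rewrite -natrX ler_nat; apply: ltnW; exact: ltn_expl.
Qed.

(** Dyadic shells of the distance to [G], written without an infimum so that an empty [G] needs no
    convention. Layer 0 has no upper bound. *)
Definition layer E G n : set 'rV[R]_d :=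
  [set x | [/\ E x, forall y, G y -> 2^-1 ^+ n <= edist x y &
    forall m, n = m.+1 -> exists2 y, G y & edist x y < 2^-1 ^+ m]].

Lemma layer_cover E G x e : E x -> 0 < e -> (forall y, G y -> e <= edist x y) ->
  exists n, layer E G n x.
Proof.
move=> Ex e0 far; have [n0 n0e] := geometric_small e0.
have ex : exists n, `[< forall y, G y -> 2^-1 ^+ n <= edist x y >].
  by exists n0; apply/asboolP => y /far; exact: le_trans.
case: (ex_minnP ex) => n /asboolP nP nmin; exists n; split=> // m nm.
apply: contrapT => none; suff : (n <= m)%N by rewrite nm ltnn.
apply: nmin; apply/asboolP => y Gy; rewrite leNgt; apply/negP => xy.
by apply: none; exists y.
Qed.

Lemma closure_layer_ge E G n x y : closure (layer E G n) x -> G y ->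
  2^-1 ^+ n <= edist x y.
Proof.
move=> nx Gy; apply/ler_addgt0Pr => h h0.
have [z [_ zG _] xz] := closure_edist h0 nx.
by have := zG _ Gy; have := edist_triangle x z y; rewrite (edistC z x); lra.
Qed.

Lemma closure_layer_lt E G m x h : closure (layer E G m.+1) x -> 0 < h ->
  exists2 y, G y & edist x y < 2^-1 ^+ m + h.
Proof.
move=> mx h0; have [z [_ _ /(_ m erefl)[y Gy zy]] xz] := closure_edist h0 mx.
by exists y => //; have := edist_triangle z x y; lra.
Qed.

(** [x] is at distance at least 2^-n from [G], [y] at distance at most half of that. *)
Lemma layer_far E G n m x y : (n.+1 < m)%N -> closure (layer E G n) x ->
  closure (layer E G m) y -> 2^-1 ^+ n.+1 <= edist x y.
Proof.
case: m => // m nm nx my; apply/ler_addgt0Pr => h h0.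
have [g Gg yg] := closure_layer_lt my h0.
have := closure_layer_ge nx Gg; have := edist_triangle y x g.
have : (2^-1 : R) ^+ m <= 2^-1 ^+ n.+1.
  by rewrite ler_wiXn2l// invf_le1// ler1n.
rewrite exprS; lra.
Qed.

(** Equal parity rules out adjacent layers. Each of the two labels is at most a quarter of 2^-n, so
    together they fit into the gap 2^-(n+1). *)
Lemma layer_separated E G rho n m x y : 0 <= rho <= 4^-1 -> odd n = odd m ->
  (n < m)%N -> closure (layer E G n) x -> closure (layer E G m) y ->
  rho * 2^-1 ^+ n + rho * 2^-1 ^+ m <= edist x y.
Proof.
move=> /andP[rho0 rho4] nm_odd nm nx my.
have nm2 : (n.+1 < m)%N.
  by rewrite ltn_neqAle nm andbT; apply/eqP => /(congr1 odd)/=; rewrite nm_odd; case: odd.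
apply: le_trans (layer_far nm2 nx my).
have mn : (2^-1 : R) ^+ m <= 2^-1 ^+ n.
  by rewrite ler_wiXn2l ?invf_le1 ?ler1n// ltnW.
have n0 : 0 <= (2^-1 : R) ^+ n by rewrite exprn_ge0.
rewrite -mulrDr; apply: (@le_trans _ _ (4^-1 * (2^-1 ^+ n + 2^-1 ^+ m))).
  by apply: ler_wpM2r => //; rewrite addr_ge0// exprn_ge0.
rewrite exprS; lra.
Qed.

(* Whitney-type cover: the grid is refined towards [G], so that the cells of
   a given colour (parity of the layer and residues of the grid coordinates)
   are far apart and carry a single packing avoiding [G]. *)
Lemma M_delta_remainder s delta rho E G b : 0 < rho -> rho <= delta ->
  rho <= 4^-1 -> compact E ->
  (forall x, E x -> ~ G x -> exists2 e, 0 < e & forall y, G y -> e <= edist x y) ->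
  (forall (J : finType) (x : J -> 'rV[R]_d) (r : J -> R), packing x r ->
    (forall j, E (x j)) -> (forall j, r j <= rho) ->
    (forall j y, G y -> r j <= edist (x j) y) -> \sum_j (2 * r j) `^ s <= b) ->
  (M_delta s delta (E `\` G) <=
    (#|{: bool * {ffun 'I_d -> 'I_(2 * d).+3}}|%:R * b)%:E)%E.
Proof.
move=> rho0 rho_delta rho4 cE gap bound.
(* [rr n] is the label in layer [n]. The side [ee n] keeps cell diameters below it, while the gap
   2(d + 1)[ee n] of [cell_far] is exactly two labels. *)
pose rr n := rho * 2^-1 ^+ n; pose ee n := rr n / d.+1%:R.
have rr0 n : 0 < rr n by rewrite mulr_gt0// exprn_gt0.
have ee0 n : 0 < ee n by rewrite divr_gt0.
have rr_le n : rr n <= rho.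
  by rewrite ler_piMr ?(ltW rho0)// exprn_ile1// invf_le1// ler1n.
pose K (p : nat * {ffun 'I_d -> int}) := layer E G p.1 `&` cell (ee p.1) p.2.
have KL p x : closure (K p) x -> closure (layer E G p.1) x.
  by apply: closureS => ? [].
have KC p x : closure (K p) x -> closure (cell (ee p.1) p.2) x.
  by apply: closureS => ? [].
apply: (M_delta_le_count (K := K) (rho := fun p => rr p.1)).
- exact: lt_le_trans rho_delta.
- move=> x [Ex Gx]; have [e e0 ey] := gap _ Ex Gx.
  have [n nx] := layer_cover Ex e0 ey.
  by have [z zx] := cell_cover x (ee0 n); exists (n, z).
- move=> p; apply/diam_leP; first by rewrite lee_fin ltW.
  move=> x y [_ zx] [_ zy]; rewrite lee_fin; apply: le_trans (cell_edist (ee0 _) zx zy) _.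
  by rewrite mulrC /ee -mulrA ler_piMr ?(ltW (rr0 _))// mulrC ler_pdivrMr// mul1r ler_nat.
- by move=> p; rewrite rr0/=; apply: le_trans (rr_le _) _.
move=> l ul; pose colour (p : nat * {ffun 'I_d -> int}) := (odd p.1, cell_colour p.2).
rewrite (partition_big colour xpredT)//=.
apply: (@le_trans _ _ (\sum_(k : bool * {ffun 'I_d -> 'I_(2 * d).+3}) b%:E)%E); last first.
  by rewrite sumEFin sumr_const -[in leLHS]mulr_natl.
apply: lee_sum => k _; rewrite -big_filter.
apply: (sum_Phi_separated (rho := fun p => rr p.1)) => //; first by rewrite filter_uniq.
  move=> p q x y; rewrite !mem_filter => /andP[/eqP pk _] /andP[/eqP qk _] pq Kx Ky.
  have [podd pcol] : odd p.1 = odd q.1 /\ cell_colour p.2 = cell_colour q.2.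
    by move: pk; rewrite -qk => -[].
  have rho_itv : 0 <= rho <= 4^-1 by rewrite ltW.
  have [lt|lt|eq] := ltngtP p.1 q.1.
  - exact: (layer_separated rho_itv podd lt (KL _ _ Kx) (KL _ _ Ky)).
  - rewrite addrC edistC.
    exact: (layer_separated rho_itv (esym podd) lt (KL _ _ Ky) (KL _ _ Kx)).
  have neq : p.2 != q.2.
    by apply: contra pq => /eqP eq2; rewrite [p]surjective_pairing eq eq2 -surjective_pairing.
  have := KC _ _ Kx; have := KC _ _ Ky; rewrite eq => qy px.
  have := cell_far (ee0 _) pcol neq px qy.
  by rewrite /ee [X in 2 * X]mulrC divfK ?pnatr_eq0// mulr_natl mulr2n.
(* The merged packing avoids [G]: its radii in layer [n] are at most [rho] times 2^-n, and that
   layer keeps distance 2^-n from [G]. *)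
move=> J x r pack Kx; apply: (bound J x r pack) => [j|j|j y Gy];
  have [p _ [px rp]] := Kx j.
- apply: (compact_closed_rV cE); apply: closureS (px) => ? [[]]//.
- exact: le_trans rp (rr_le _).
- apply: le_trans rp _; apply: le_trans (closure_layer_ge (KL _ _ px) Gy).
  by rewrite ler_piMl ?exprn_ge0//; lra.
Qed.

End Layers.

(** * Equality of the labelled quantities for one quasi-self-similar set *)

Section Main.
Context {R : realType} {d : nat}.
Variables (E : set 'rV[R]_d) (s : R) (p q : 'rV[R]_d).
Hypotheses (cE : compact E) (Ep : E p) (Eq : E q) (pq : p != q).
Hypotheses (crit : critical_exponent E s) (qE : quasi_self_similar E).

Let s0 : 0 < s. Proof. by case: crit. Qed.

(* Among the finite disjoint families of small copies of [E] choose one whose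
   sum of [s]-th powers of ratios is almost maximal: there is no room left for
   a substantial packing of the remainder. *)
Lemma exhausting_copies delta e : 0 < delta -> 0 < e ->
  exists (I : finType) (c : I -> R) (f : I -> 'rV[R]_d -> 'rV[R]_d),
    [/\ disjoint_copies E c f, forall i, c i <= delta &
      exists2 rho, 0 < rho &
        forall (J : finType) (x : J -> 'rV[R]_d) (r : J -> R), packing x r ->
        (forall j, E (x j)) -> (forall j, r j <= rho) ->
        (forall j y, (\bigcup_i f i @` E) y -> r j <= edist (x j) y) ->
        \sum_j (2 * r j) `^ s <= e].
Proof.
move=> delta0 e0.
(* A copy in a ball of radius at most rho/3 moves [p] and [q] to points at distance at most 2rho/3,
   so its ratio is at most [delta]. *)
pose rho := delta * edist p q; have pq0 := edist_gt0 pq.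
have rho0 : 0 < rho by rewrite mulr_gt0.
have [a a0 qa] := qE rho0.
have a6 : 0 < a / 6 by rewrite divr_gt0.
pose T := [set v | exists (I : finType) (c : I -> R)
  (f : I -> 'rV[R]_d -> 'rV[R]_d), [/\ disjoint_copies E c f,
    forall i, c i <= delta & v = \sum_i c i `^ s]].
have Tle v : T v -> v <= 1.
  by move=> [I [c [f [copies _ ->]]]]; exact: (sum_copies_le1 cE Ep Eq pq crit copies).
have supT : has_sup T.
  split; last by exists 1.
  exists 0, void, (fun i : void => match i with end),
    (fun i : void => match i with end).
  by split; [split; case|case|rewrite big_pred0].
have ae : 0 < (a / 6) `^ s * e by rewrite mulr_gt0 ?powR_gt0.
have [_ [I [c [f [copies c_le ->]]]] near_sup] := sup_adherent ae supT.
exists I, c, f; split=> //; exists rho => // J x r pack Ex r_le far.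
have r2 j : r j <= 2 * rho by have := r_le j; have := rho0; lra.
have {}far i j y : E y -> r j <= edist (x j) (f i y).
  by move=> Ey; apply: far; exists i => //; exists y.
have [c' [f' [copies' c'P]]] := extend_disjoint_copies qa copies pack Ex r2 far.
have r0 j : 0 < r j by case: pack.
have c'0 j : 0 < c' j by case: copies' => /(_ (inr j))[].
have c'_le j : c' j <= delta.
  rewrite -(ler_pM2r pq0).
  have <- : edist (f' j p) (f' j q) = c' j * edist p q.
    by case: copies' => /(_ (inr j))[_ ->].
  have [_ near] := c'P j; have := near p Ep; have := near q Eq.
  have := edist_triangle (x j) (f' j p) (f' j q); rewrite (edistC _ (x j)).
  have := r_le j; have := r0 j; rewrite /rho; lra.
have : \sum_i c i `^ s + \sum_j c' j `^ s <= sup T.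
  apply: sup_upper_bound => //; exists (I + J)%type,
    (fun k => match k with inl i => c i | inr j => c' j end),
    (fun k => match k with inl i => f i | inr j => f' j end).
  by split=> //; [case|rewrite big_sumType].
move=> le_sup; have sum_c' : \sum_j c' j `^ s <= (a / 6) `^ s * e by lra.
rewrite -(ler_pM2l (powR_gt0 s a6)); apply: le_trans sum_c'.
rewrite mulr_sumr; apply: ler_sum => j _.
have rj : 0 <= 2 * r j by rewrite mulr_ge0// ltW.
rewrite -(powRM s (ltW a6) rj); apply: (ge0_ler_powR (ltW s0)).
- by rewrite nnegrE mulr_ge0// ltW.
- by rewrite nnegrE ltW.
- by apply: le_trans (c'P j).1; rewrite le_eqVlt; apply/orP; left; apply/eqP; field.
Qed.

(** A cover of finite cost has bounded labels on its nonempty sets; this decides how small the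
    copies must be. *)
Lemma bounded_radii (A : nat -> set 'rV[R]_d) (rho : nat -> R) :
  (forall j, 0 < rho j) -> (\sum_(j <oo) Phi s (A j) (rho j) < +oo)%E ->
  exists2 rmax, 0 < rmax & forall j, A j !=set0 -> rho j <= rmax.
Proof.
move=> rho0; have Phi0 j : (0 <= Phi s (A j) (rho j))%E by exact: Phi_ge0.
set T := (\sum_(j <oo) _)%E => Ty.
have T0 : (0 <= T)%E by apply: nneseries_ge0.
have Tfin : T \is a fin_num by rewrite ge0_fin_numE.
have t0 : 0 <= fine T by exact: fine_ge0.
have t1 : 0 < fine T + 1 by lra.
exists ((fine T + 1) `^ s^-1 / 2) => [|j Aj].
  by rewrite divr_gt0// powR_gt0.
set y := (fine T + 1) `^ s^-1.
have yT : y `^ s = fine T + 1 by rewrite -powRrM mulVf ?gt_eqF// powRr1 ?ltW.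
have h : ((2 * rho j)%:E `^ s <= (y `^ s)%:E)%E.
  rewrite poweR_EFin yT; apply: (@le_trans _ _ (fine T)%:E); last first.
    by rewrite lee_fin; lra.
  rewrite fineK//; apply: le_trans (powR_radius_le_Phi s Aj (rho0 j)) _.
  have /= := @sum_uniq_le_nneseries R (fun j => Phi s (A j) (rho j)) [:: j].
  by rewrite big_seq1; apply.
have r2 : (0 <= (2 * rho j)%:E)%E by rewrite lee_fin mulr_ge0// ltW.
by have := poweR_le_root s0 r2 (powR_ge0 _ _) h;
  rewrite lee_fin ler_pdivlMr// mulrC.
Qed.

Lemma M_delta_le_M_infty delta : 0 < delta ->
  (M_delta s delta E <= M_infty s E)%E.
Proof.
move=> delta0; apply: le_ereal_inf_tmp => _ [A [rho [EA dA rho0 ->]]].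
set T := (\sum_(j <oo) _)%E.
have T0 : (0 <= T)%E by apply: nneseries_ge0 => *; exact: Phi_ge0.
have [->|Ty] := eqVneq T +oo%E; first by rewrite leey.
have {}Ty : (T < +oo)%E by rewrite ltey.
have Tfin : T \is a fin_num by rewrite ge0_fin_numE.
have [rmax rmax0 rho_le] := bounded_radii rho0 Ty.
pose N : R := #|{: bool * {ffun 'I_d -> 'I_(2 * d).+3}}|%:R.
apply/lee_addgt0Pr => e e0.
have eN : 0 < e / (N + 1) by rewrite divr_gt0// ltr_wpDl// ler0n.
(* Copies of ratio at most [delta / rmax] bring all labels below [delta]; the remainder costs at
   most [N] times the packing bound [e / (N + 1)]. *)
have dr : 0 < delta / rmax by rewrite divr_gt0.
have [I [c [f [copies c_le [rho' rho'0 small]]]]] := exhausting_copies dr eN.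
have [simf fE _] := copies.
pose G := \bigcup_i f i @` E.
have -> : E = G `|` (E `\` G).
  apply/seteqP; split=> [x Ex|x [[i _ /fE]|[]]//].
  by have [Gx|Gx] := pselect (G x); [left|right].
apply: le_trans (M_delta_setU s _ _ delta0) _; apply: leeD.
  apply: le_trans (M_delta_bigcup s _ delta0) _.
  apply: (@le_trans _ _ (\sum_i (c i `^ s)%:E * T)%E).
    apply: lee_sum => i _.
    apply: (M_delta_image s0 cE (simf i) EA dA rho0 rho_le rmax0).
    by rewrite -ler_pdivlMr.
  rewrite -ge0_sume_distrl; last by move=> i _; rewrite lee_fin powR_ge0.
  rewrite sumEFin -[leRHS]mul1e; apply: lee_wpmul2r => //.
  by rewrite lee_fin; exact: (sum_copies_le1 cE Ep Eq pq crit copies).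
pose rho'' := Num.min rho' (Num.min delta 4^-1).
apply: (@le_trans _ _ (N * (e / (N + 1)))%:E); last first.
  have N0 : 0 <= N by rewrite ler0n.
  rewrite lee_fin mulrA ler_pdivrMr; last by lra.
  by rewrite mulrDr mulr1 mulrC lerDl ltW.
apply: (@M_delta_remainder _ _ s delta rho'') => //.
- by rewrite /rho'' !lt_min rho'0 delta0 invr_gt0 ltr0n.
- by rewrite /rho'' !ge_min lexx orbT.
- by rewrite /rho'' !ge_min lexx !orbT.
- move=> x Ex Gx.
  have /choice[h hP] i : exists h : R, 0 < h /\
      forall y, (f i @` E) y -> h <= edist x y.
    have disj : [set x] `&` f i @` E = set0.
      by rewrite -subset0 => _ [-> fx]; apply: Gx; exists i.
    have [h h0 hP] := compact_disjoint_gap (@compact_set1 _ x)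
      (similarity_compact (simf i) cE) disj.
    by exists h; split=> // y fy; exact: hP.
  have [g g0 gh] := fin_lower_bound (fun i => (hP i).1).
  by exists g => // y [i _ fy]; apply: le_trans (gh i) _; exact: (hP i).2.
- move=> J x r pack Ex r_le; apply: small => // j.
  by apply: le_trans (r_le j) _; rewrite ge_min lexx.
Qed.

Lemma M_infty_fin : (M_infty s E < +oo)%E.
Proof.
have [D D0 ED] := compact_bounded cE.
have [C C0 bound] := packing_sum_bound cE Ep Eq pq crit qE D0.
apply: (@le_lt_trans _ _ C%:E); last exact: ltry.
apply: (@le_trans _ _ (\sum_(j <oo) Phi s (if j == 0%N then E else set0) D)%E).
  apply: ereal_inf_lbound; exists (fun j => if j == 0%N then E else set0), (fun=> D).
  split=> //; first by move=> x Ex; exists 0%N.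
  move=> j; case: eqP => _; last by rewrite diam0 lee_fin ltW.
  by apply/diam_leP => [|x y Ex Ey]; rewrite lee_fin ?ED// ltW.
rewrite nneseries_recl//; last by move=> j _; exact: Phi_ge0.
rewrite eseries0 ?adde0 => [|[|j]//= _ _]; last exact: Phi_set0.
apply: Phi_le => [|J x r pack Ex r_le]; first by rewrite lee_fin ltW.
rewrite lee_fin; apply: (bound J x r pack) => // j; exact: compact_closed_rV (Ex j).
Qed.

Lemma M_equalities delta : 0 < delta ->
  [/\ M_infty s E = M_delta s delta E, M_delta s delta E = M_lim s E
    & (M_lim s E < +oo)%E].
Proof.
have eq_delta e : 0 < e -> M_infty s E = M_delta s e E.
  by move=> e0; apply: le_anti; rewrite M_infty_le_M_delta M_delta_le_M_infty.
have lim : M_lim s E = M_infty s E.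
  apply: le_anti; apply/andP; split.
    by apply: ge_ereal_sup => _ [e /= /andP[e0 _] <-]; rewrite -(eq_delta e e0).
  apply: ereal_sup_ubound; exists 2^-1; first by rewrite /= invr_gt0 ltr0n invf_lt1// ltr1n.
  by rewrite -eq_delta// invr_gt0.
by move=> delta0; rewrite lim -eq_delta//; split=> //; exact: M_infty_fin.
Qed.

End Main.

(** * Graph-directed systems *)

(** Only some finite null exponent is wanted. With d + 1, about L^d cubes of diameter of order 1/L
    cost in total a multiple of 1/L. *)
Lemma hnull_compact {R : realType} {d : nat} (K : set 'rV[R]_d) :
  compact K -> hnull d.+1%:R K.
Proof.
move=> cK; have t0 : 0 < d.+1%:R :> R by rewrite ltr0n.
have [->|/set0P[x0 Kx0]] := eqVneq K set0.
  apply: (hnull_count t0) => e e0; exists void, (fun i : void => match i with end).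
  by split=> // -[|[]]// _; rewrite big_nil lee_fin ltW.
have [D D0 KD] := compact_bounded cK.
apply: (hnull_count t0) => e e0.
pose C := 2 ^+ d * (d%:R * (2 * D)) ^+ d.+1.
have C0 : 0 <= C by rewrite !mulr_ge0 ?exprn_ge0// !mulr_ge0// ltW.
pose L := (Num.truncn (C / e)).+1.
have L0 : 0 < L%:R :> R by rewrite ltr0n.
have CL : C / L%:R <= e.
  by rewrite ler_pdivrMr// mulrC -ler_pdivrMr// ltW// truncnS_gt.
pose h := 2 * D / L%:R.
have h0 : 0 < h by rewrite divr_gt0// mulr_gt0.
have dh0 : 0 <= d%:R * h by apply: mulr_ge0 => //; exact: ltW.
pose g (x : 'rV[R]_d) k := Num.truncn ((x 0 k - x0 0 k + D) / h).
(* The index [L] occurs when a coordinate exceeds that of [x0] by exactly [D], hence L + 1 values;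
   the count below uses L + 1 <= 2L. *)
pose U (z : {ffun 'I_d -> 'I_L.+1}) := K `&` [set x | forall k, g x k = z k :> nat].
exists {ffun 'I_d -> 'I_L.+1}, U; split.
  move=> x Kx; exists [ffun k => inord (g x k)] => //; split=> // k.
  rewrite ffunE inordK// /g ltnS.
  have := le_trans (coord_le_edist x x0 k) (KD _ _ Kx Kx0).
  rewrite ler_norml => /andP[x1 x2].
  have -> : L = Num.truncn (L%:R : R) by rewrite natrK.
  apply: le_truncn; rewrite ler_pdivrMr// /h mulrCA mulfV ?gt_eqF// mulr1; lra.
have dU z : (diam (U z) <= (d%:R * h)%:E)%E.
  apply/diam_leP; first by rewrite lee_fin.
  move=> x y [Kx zx] [Ky zy]; rewrite lee_fin; apply: edist_le_coord => [|k].
    exact: ltW.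
  have pos u : K u -> 0 <= (u 0 k - x0 0 k + D) / h.
    move=> Ku; have := le_trans (coord_le_edist u x0 k) (KD _ _ Ku Kx0).
    by rewrite ler_norml => /andP[u1 u2]; rewrite divr_ge0 ?(ltW h0)//; lra.
  have := truncn_itv (pos _ Kx); have := truncn_itv (pos _ Ky).
  have := zx k; have := zy k; rewrite /g => -> ->.
  move=> /andP[]; rewrite ler_pdivlMr// ltr_pdivrMr// => y1 y2.
  move=> /andP[]; rewrite ler_pdivlMr// ltr_pdivrMr// => x1 x2.
  by move: x2 y2; rewrite -natr1 ler_norml => ? ?; apply/andP; split; lra.
move=> s us; apply: (@le_trans _ _ (\sum_(z <- s) ((d%:R * h) ^+ d.+1)%:E)%E).
  apply: lee_sum => z _; rewrite -(powR_mulrn _ dh0).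
  rewrite -poweR_EFin; apply: gt0_ler_poweR => //.
  - by rewrite in_itv/= diam_ge0 leey.
  - by rewrite in_itv/= lee_fin dh0 leey.
rewrite sumEFin lee_fin; apply: le_trans CL.
rewrite big_const_seq iter_addr_0 count_predT -[leLHS]mulr_natl.
have hd0 : 0 <= (d%:R * h) ^+ d.+1 by rewrite exprn_ge0.
apply: (@le_trans _ _ ((2 * L%:R) ^+ d * (d%:R * h) ^+ d.+1)).
  apply: ler_wpM2r => //; rewrite -natrM -natrX ler_nat.
  rewrite -(card_uniqP us); apply: leq_trans (max_card _) _.
  rewrite card_ffun !card_ord; case: (d) => // n.
  by rewrite leq_exp2r// mul2n -addnn -addn1 leq_add2l.
rewrite le_eqVlt; apply/orP; left; apply/eqP.
rewrite /h /C !exprMn exprVn [(_ ^- _)](_ : _ = (L%:R ^+ d * L%:R)^-1); last by rewrite exprSr.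
by field; rewrite ?expf_neq0 gt_eqF.
Qed.

Section GraphDirected.
Context {R : realType} {d : nat}.
Variables (V : finType) (edge : V -> V -> finType).
Variable (S : forall i j : V, edge i j -> 'rV[R]_d -> 'rV[R]_d).
Variable (E : V -> set 'rV[R]_d).
Hypothesis edge_conn : strongly_connected edge.
Hypothesis S_sim : forall i j (e : edge i j), contracting_similarity (S e).
Hypothesis E_neq0 : forall i, E i !=set0.
Hypothesis E_compact : forall i, compact (E i).
Hypothesis E_nonsingleton : forall i x, E i <> [set x].
Hypothesis E_eq : forall i : V,
  E i = \bigcup_(j in [set: V]) \bigcup_(e in [set: edge i j]) (S e @` E j).

Lemma edge_image_subset i j (e : edge i j) x : E j x -> E i (S e x).
Proof. by move=> Ex; rewrite E_eq; exists j => //; exists e => //; exists x. Qed.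

Lemma two_points i : exists p q, [/\ E i p, E i q & p != q].
Proof.
have [p Ep] := E_neq0 i; apply: contrapT => none; apply: (@E_nonsingleton i p).
apply/seteqP; split=> [q Eq|_ -> //].
by apply/eqP/negPn/negP => qp; apply: none; exists q, p.
Qed.

Lemma uniform_ratio_bounds : exists c0 c1 : R, [/\ 0 < c0, c0 <= 1, 0 < c1 < 1 &
  forall i j (e : edge i j), exists c, [/\ c0 <= c, c <= c1 & similarity c (S e)]].
Proof.
pose T := {ij : V * V & edge ij.1 ij.2}.
have /choice[c cP] (t : T) : exists c, 0 < c < 1 /\ similarity c (S (tagged t)).
  have [c c01 Sc] := S_sim (tagged t); exists c; split=> //.
  by split=> //; case/andP: c01.
have [k0 k00 k0c] : exists2 k, 0 < k & forall t, k <= c t.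
  by apply: fin_lower_bound => t; have [/andP[]] := cP t.
have [k1 k10 k1c] : exists2 k, 0 < k & forall t, k <= 1 - c t.
  by apply: fin_lower_bound => t; have [/andP[_]] := cP t; rewrite subr_gt0.
(* The truncations keep the bounds on [c0] and [c1] valid even for an empty edge set. *)
exists (Num.min k0 1), (Num.max (1 - k1) 2^-1); split.
- by rewrite lt_min k00 ltr01.
- by rewrite ge_min lexx orbT.
- by rewrite lt_max gt_max invr_gt0 ltr0n orbT/= gtrBl k10 invf_lt1// ltr1n.
move=> i j e; pose t : T := existT (fun ij : V * V => edge ij.1 ij.2) (i, j) e.
exists (c t); split; last by case: (cP t).
- by rewrite ge_min k0c.
- by have := k1c t; rewrite le_max => kt; apply/orP; left; lra.
Qed.

Lemma component_embedding i j :
  exists c f, similarity c f /\ forall x, E j x -> E i (f x).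
Proof.
have /connectP[p pp ->] := edge_conn i j.
elim: p i pp => [|k p ih] i /=; first by exists 1, id; split=> //; exact: similarity_id.
move=> /andP[/card_gt0P[e _] /ih[c [f [simf fE]]]].
have [c' c'01 Sc'] := S_sim e.
exists (c' * c), (S e \o f); split.
  by apply: similarity_comp => //; split=> //; case/andP: c'01.
by move=> x /fE Ekx; exact: edge_image_subset.
Qed.

(** An address of [x] is followed until [D] times the ratio first drops to [r] or below; one step
    earlier it was larger, so the last edge loses at most the factor [c0]. [n] bounds the number of
    steps, and each step divides [r] by the ratio of its edge. *)
Lemma zoom c0 c1 D n i x r : 0 < c0 <= 1 -> 0 < c1 -> 0 < D ->
  (forall i j (e : edge i j), exists c, [/\ c0 <= c, c <= c1 & similarity c (S e)]) ->
  E i x -> 0 < r -> c1 ^+ n * D <= r -> r <= D ->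
  exists j c f, [/\ similarity c f, forall y, E j y -> E i (f y),
    exists2 y, E j y & f y = x, c * D <= r & c0 * r / D <= c].
Proof.
move=> /andP[c00 c01] c10 D0 ratios; elim: n i x r => [|n ih] i x r Ex r0 nr rD.
  exists i, 1, id; split=> //; first exact: similarity_id.
  - by exists x.
  - by rewrite ler_pdivrMr// mul1r (le_trans _ rD)// ler_piMl// ltW.
move: (Ex); rewrite {1}(E_eq i) => -[j _ [e _ [y Ejy yx]]].
have [c [c0c cc1 simS]] := ratios _ _ e; have c_gt0 : 0 < c by case: simS.
have [cDr|rcD] := leP (c * D) r.
  exists j, c, (S e); split=> //; first by move=> z; exact: edge_image_subset.
    by exists y.
  rewrite ler_pdivrMr//; apply: ler_pM => //; exact: ltW.
have [|||k [c' [f [simf fE [z Ez zy] c'D rc']]]] := ih j y (r / c) Ejy.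
- by rewrite divr_gt0.
- rewrite ler_pdivlMr//; apply: le_trans nr.
  rewrite exprS [leLHS]mulrC -[leRHS]mulrA; apply: ler_wpM2r => //.
  by rewrite mulr_ge0 ?exprn_ge0 ?ltW.
- by rewrite ler_pdivrMr// mulrC ltW.
exists k, (c * c'), (S e \o f); split.
- exact: similarity_comp.
- by move=> w /fE; exact: edge_image_subset.
- by exists z => //=; rewrite zy.
- by rewrite -mulrA mulrC -ler_pdivlMr.
- rewrite [leRHS]mulrC -ler_pdivrMr//; apply: le_trans rc'.
  by rewrite le_eqVlt; apply/orP; left; apply/eqP; field; rewrite !gt_eqF.
Qed.

(** [zoom] ends in a copy of some [E j]; a fixed embedding of [E i] into [E j] turns it into a copy
    of [E i]. There are finitely many [j], so this costs at most a factor [b]. *)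
Lemma component_quasi_self_similar i : quasi_self_similar (E i).
Proof.
move=> r0 r00; have [c0 [c1 [c00 c01 /andP[c10 c11] ratios]]] := uniform_ratio_bounds.
have /choice[Di DiP] j : exists D, 0 < D /\
    forall x y, E j x -> E j y -> edist x y <= D.
  by have [D D0 ED] := compact_bounded (@E_compact j); exists D.
(* One bound for all diameters; the summand [r0] ensures [r <= D]. *)
pose D := r0 + \sum_j Di j.
have sum0 : 0 <= \sum_j Di j by apply: sumr_ge0 => j _; apply: ltW; case: (DiP j).
have D0 : 0 < D by rewrite /D; lra.
have ED j x y : E j x -> E j y -> edist x y <= D.
  move=> Ex Ey; apply: le_trans ((DiP j).2 _ _ Ex Ey) _.
  rewrite /D (bigD1 j)//= addrCA lerDl addr_ge0 ?(ltW r00)// sumr_ge0// => k _.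
  by apply: ltW; case: (DiP k).
have /choice[h hP] j : exists h : R * ('rV[R]_d -> 'rV[R]_d),
    similarity h.1 h.2 /\ forall x, E i x -> E j (h.2 x).
  by have [c [f cf]] := component_embedding j i; exists (c, f).
have [b b0 bh] : exists2 b, 0 < b & forall j, b <= (h j).1.
  by apply: fin_lower_bound => j; case: (hP j) => -[].
exists (c0 / D * b) => [|x r Ex /andP[r_gt0 r_le]].
  by rewrite mulr_gt0// divr_gt0.
have [n nr] : exists n, c1 ^+ n * D <= r.
  have c1n : `|c1| < 1 by rewrite gtr0_norm.
  have /cvgrPdist_le/(_ (r / D))[|N _ /(_ N (leqnn N))] := cvg_expr c1n.
    by rewrite divr_gt0.
  rewrite sub0r normrN ger0_norm ?exprn_ge0 ?(ltW c10)// => h1; exists N.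
  by rewrite -ler_pdivlMr.
have rD : r <= D by rewrite /D; lra.
have c0_itv : 0 < c0 <= 1 by rewrite c00.
have [j [c [f [simf fE [y Ey yx] cD rc]]]] := zoom c0_itv c10 D0 ratios Ex r_gt0 nr rD.
have [simh hE] := hP j; have c_gt0 : 0 < c by case: simf.
exists (c * (h j).1), (f \o (h j).2); split.
- exact: similarity_comp.
- rewrite mulrAC; apply: ler_pM => //; last by rewrite mulrAC.
  + by apply: mulr_ge0; rewrite ?divr_ge0 ?ltW.
  + exact: ltW.
- move=> z Ez; split; first by apply: fE; exact: hE.
  rewrite -yx /=; have [_ ->] := simf; apply: le_trans cD.
  by rewrite ler_pM2l//; apply: (ED j) => //; exact: hE.
Qed.

Lemma hnull_component t i j : 0 < t -> hnull t (E i) -> hnull t (E j).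
Proof.
move=> t0; have [c [f [[c0 fc] fE]]] := component_embedding i j.
apply: (hnull_expanding t0 c0 (f := f)) => [x y|_ [x Ex <-]]; first by rewrite fc.
exact: fE.
Qed.

Lemma common_critical_exponent :
  exists2 s, 0 < s & forall i, critical_exponent (E i) s.
Proof.
(* Without vertices every s is common; 1 is an arbitrary choice. *)
have [i _|V0] := pickP (@predT V); last by exists 1 => // i; have := V0 i.
have [p [q [Ep Eq pq]]] := two_points i.
have d0 : 0 < d.+1%:R :> R by rewrite ltr0n.
have [s crit] := critical_exponent_exists (@E_compact i) Ep Eq pq
  (@component_quasi_self_similar i) d0 (hnull_compact (@E_compact i)).
exists s => [|j]; first by case: crit.
apply: critical_exponent_congr crit => t t0.
by split; exact: hnull_component.
Qed.

End GraphDirected.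

Theorem corollary1p5 (R : realType) (d : nat)
    (V : finType) (edge : V -> V -> finType)
    (S : forall i j : V, edge i j -> 'rV[R]_d -> 'rV[R]_d)
    (E : V -> set 'rV[R]_d)
    (edge_conn : strongly_connected edge)
    (S_sim : forall (i j : V) (e : edge i j), contracting_similarity (S i j e))
    (E_neq0 : forall i : V, E i !=set0)
    (E_compact : forall i : V, compact (E i))
    (E_nonsingleton : forall (i : V) (x : 'rV[R]_d), E i <> [set x])
    (E_eq : forall i : V,
      E i = \bigcup_(j in [set: V]) \bigcup_(e in [set: edge i j])
              (S i j e @` E j)) :
  exists s : R,
    [/\ 0 < s,
        forall i : V, hausdorff_dim (E i) = s%:E /\ packing_dim (E i) = s%:E
      & forall (i : V) (delta : R), 0 < delta ->
          [/\ M_infty s (E i) = M_delta s delta (E i),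
              M_delta s delta (E i) = M_lim s (E i)
            & (M_lim s (E i) < +oo)%E]].
Proof.
have [s s0 crit] := common_critical_exponent edge_conn S_sim E_neq0 E_compact
  E_nonsingleton E_eq.
have qE := component_quasi_self_similar edge_conn S_sim E_compact E_eq.
exists s; split=> // i; have [p [q [Ep Eq pq]]] := two_points E_neq0 E_nonsingleton i.
  split; first exact: hausdorff_dim_critical.
  have [C C0 bound] := packing_sum_bound (E_compact i) Ep Eq pq (crit i) (qE i) ltr01.
  exact: packing_dim_critical C0 bound.
by move=> delta; exact: (M_equalities (E_compact i) Ep Eq pq (crit i) (qE i)).
Qed.
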